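(* Let $d\ge3$, $q\in[1,\infty)$, and let $p\in(0,1)$ be such that there is a unique infinite volume $(d-1)$-dimensional plaquette random-cluster measure on $\mathbb Z^d$ with parameters $p,q$. Then $$\tau''_{p,q}=\tau_{p^*(p),q},\qquad p^*(p)=\frac{(1-p)q}{(1-p)q+p},$$ where $\tau''_{p,q}$ is the Wilson loop tension defined with free boundary conditions on cubes and $\tau$ is the surface tension of the classical random-cluster model, both defined in the context.
   Context: **Cells.** $\mathbb Z^d$ is the cubical complex on $\mathbb R^d$ whose $j$-cells ($j$-plaquettes) are unit $j$-cubes with integer corners; the dual lattice is $\mathbb Z^d+(\tfrac12,\dots,\tfrac12)$, and each $(d-1)$-plaquette is crossed at its center by exactly one dual edge. $\Lambda_N=[-N,N]^d$. Homology is reduced. **Plaquette random-cluster model (PRCM).** A boundary condition $\xi$ on $\Lambda_n$ is a set of $(d-1)$-plaquettes of $\mathbb Z^d$, each either not contained in $\Lambda_n$ or contained in $\partial\Lambda_n$. For a set $P$ of $(d-1)$-plaquettes contained in $\Lambda_n$ but not in $\partial\Lambda_n$ (identified with the complex obtained by adding the $(d-2)$-skeleton of $\Lambda_n$), let $Q$ be the set of dual edges crossing the remaining such plaquettes and let $Q^\xi$ be the graph on all dual vertices whose edges are $Q$ together with all dual edges crossing plaquettes that are not in $\Lambda_n$ or are in $\partial\Lambda_n$, and that do not belong to $\xi$. $\mu^{\xi}_{\Lambda_n,p,q,d-1}(P)\propto(p^* )^{|Q|}(1-p^* )^{|P|}q^{\kappa}$, with $p^*=p^*(p)$ and $\kappa$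 the number of components of $Q^\xi$ containing a dual vertex in $\Lambda_n$. The free measure $\mu^{\mathbf f}_{\Lambda_n,p,q,d-1}$ is the case $\xi=\emptyset$; equivalently it is proportional to $p^{|P|}(1-p)^{n'-|P|}q^{\dim H_{d-2}(P;\mathbb Q)}$, with $n'$ the number of plaquettes involved. An infinite volume measure is any weak limit of $\mu^{\xi_n}_{\Lambda_n,p,q,d-1}$ as $n\to\infty$. **Wilson loop tension with free boundary conditions.** Let $\gamma_N=\partial[-N,N]^{d-1}\times\{0\}$, viewed as a $(d-2)$-cycle, and let $V_{\gamma_N}$ be the event that $\gamma_N$ is null-homologous in $P$ (the $(d-1)$-dimensional configuration in $\Lambda_N$), with coefficients in $\mathbb Z$ or in $\mathbb Z/m\mathbb Z$ for some $m\geq 2$. Then $$\tau''_{p,q}=\lim_{N\to\infty}\frac{-\log\mu^{\mathbf f}_{\Lambda_N,p,q,d-1}(V_{\gamma_N})}{(2N)^{d-1}}.$$ **Surface tension.** $\mu^{\mathbf w}_{\Lambda_N,p,q,1}$ is the wired classical random-cluster measure: the random set $Q$ of edges of $\Lambda_N$ not contained in $\partial\Lambda_N$ has probability proportional to $p^{|Q|}(1-p)^{E_N-|Q|}q^{\kappa(Q)}$, with $E_N$ the number of such edges and $\kappa(Q)$ the number of components of $Q\cup\partial\Lambda_N$. With $\partial^{\pm}\Lambda_N=\partial\Lambda_N\cap\{\pm x_d>0\}$, $$\tau_{p,q}=\lim_{N\to\infty}\frac{-\log \mu^{\mathbf w}_{\Lambda_N,p,q,1}\left(\text{no path of edges of }Q\text{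 joins }\partial^+\Lambda_N\text{ to }\partial^-\Lambda_N\right)}{(2N)^{d-1}}.$$ *)

(* Defs.v *)
(* Libraries: MathComp and MathComp-Analysis. *)
From HB Require Import structures.
From mathcomp Require Import all_boot all_order all_algebra.
From mathcomp Require Import finmap.
From mathcomp Require Import all_classical all_reals all_analysis.
Import Order.TTheory GRing.Theory Num.Theory.
Import numFieldNormedType.Exports.

Set Implicit Arguments.
Unset Strict Implicit.
Unset Printing Implicit Defensive.

Local Open Scope classical_set_scope.
Local Open Scope ring_scope.

Definition vertex (d : nat) := {ffun 'I_d -> int}.

Definition unit_vector (d : nat) (i : 'I_d) : vertex d :=
  [ffun j => (j == i)%:Z].

(* The cell (x, S) is the cube with lowest corner x extending by 1 in the
   directions of S: the product of [x_i, x_i + 1] over i in S and of {x_i} over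
   the other i.  Its dimension is #|S|. *)
Definition cell (d : nat) := (vertex d * {set 'I_d})%type.

(* Containment in Lambda_n = [-n, n]^d. *)
Definition in_box (d n : nat) (c : cell d) : bool :=
  [forall i, (- n%:Z <= c.1 i) && (c.1 i + (i \in c.2)%:Z <= n%:Z)].

(* Containment in the topological boundary of Lambda_n: being convex, a cell
   contained in the boundary lies in one of the faces x_i = n or x_i = - n. *)
Definition in_bdbox (d n : nat) (c : cell d) : bool :=
  in_box n c && [exists i, (i \notin c.2) && (`|c.1 i| == n%:Z)].

Definition interior_cell (d n : nat) (c : cell d) : bool :=
  in_box n c && ~~ in_bdbox n c.

(* The edge (x, i) joins x to x + e_i. *)
Definition edge (d : nat) := (vertex d * 'I_d)%type.

Definition edge_cell (d : nat) (e : edge d) : cell d := (e.1, [set e.2])%SET.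

(* The plaquette (x, i) is the (d-1)-cell with lowest corner x and normal
   direction i. *)
Definition plaquette (d : nat) := (vertex d * 'I_d)%type.

Definition plaquette_cell (d : nat) (c : plaquette d) : cell d :=
  (c.1, ~: [set c.2])%SET.

(* The dual lattice is identified with Z^d by encoding the dual vertex
   x + (1/2, ..., 1/2) as x.  The plaquette (x, i) is centered at
   x + (1/2, ..., 1/2) - e_i / 2, so the dual edge crossing it joins the dual
   vertices encoded by x - e_i and x. *)
Definition dual_edge (d : nat) (c : plaquette d) : edge d :=
  (c.1 - unit_vector c.2, c.2).

(* x + (1/2, ..., 1/2) belongs to Lambda_n iff the unit cube of which it is the
   center is contained in Lambda_n. *)
Definition dual_vertex_in_box (d n : nat) (x : vertex d) : bool :=
  in_box n (x, [set: 'I_d])%SET.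

Definition vertex_in_box (d n : nat) (x : vertex d) : bool :=
  in_box n (x, finset.set0).

Definition vertex_in_bdbox (d n : nat) (x : vertex d) : bool :=
  in_bdbox n (x, finset.set0).

Definition adjacent (d : nat) (E : set (edge d)) : rel (vertex d) :=
  fun x y => `[< exists i : 'I_d, (E (x, i) /\ y = x + unit_vector i) \/
                                  (E (y, i) /\ x = y + unit_vector i) >].

Definition joined (d : nat) (E : set (edge d)) (x y : vertex d) : Prop :=
  exists s : seq (vertex d), path (adjacent E) x s /\ last x s = y.

Definition component (d : nat) (E : set (edge d)) (x : vertex d) :
  set (vertex d) := [set y | joined E x y].

(* The number of components of the graph with edge set E that meet V.  The
   value is meaningful for finite V, the only case used below. *)
Definition ncomponents (d : nat) (E : set (edge d)) (V : set (vertex d)) : nat :=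
  #|` fset_set (component E @` V)|.

(* The finiteness lemmas below ensure that the uses of [fset_set] below are
   not degenerate. *)
Lemma finite_box_vertices (d n : nat) :
  finite_set [set x : vertex d | vertex_in_box n x].
Proof.
pose f (g : {ffun 'I_d -> 'I_(n.*2.+1)}) : vertex d :=
  [ffun i => (g i : nat)%:Z - n%:Z].
apply: (@sub_finite_set _ _ (f @` setT)); last exact: finite_image.
move=> x /= /forallP xn; exists [ffun i => inord (absz (x i + n%:Z))] => //.
apply/ffunP => i; rewrite !ffunE; have /= := xn i.
rewrite finset.in_set0 addr0 => /andP[x1 x2].
have xn0 : 0 <= x i + n%:Z by rewrite -lerBlDr sub0r.
rewrite inordK; last first.
  by rewrite ltnS -lez_nat gez0_abs // -addnn PoszD lerD2r.
by rewrite gez0_abs // addrK.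
Qed.

Lemma finite_interior_cells (d n : nat) :
  finite_set [set c : cell d | interior_cell n c].
Proof.
apply: (@sub_finite_set _ _ ([set x | vertex_in_box n x] `*` setT)); last first.
  by apply: finite_setX => //; exact: finite_box_vertices.
move=> [x S] /= /andP[/forallP xn _]; split => //.
apply/forallP => i; have /= /andP[-> /= xi] := xn i.
by rewrite finset.in_set0 addr0; apply: le_trans xi; rewrite lerDl.
Qed.

Lemma finite_interior_plaquettes (d n : nat) :
  finite_set [set c : plaquette d | interior_cell n (plaquette_cell c)].
Proof.
apply: (@sub_finite_set _ _ ((fst @` [set c : cell d | interior_cell n c])
  `*` setT)).
  by move=> [x i] /= H; split => //; exists (plaquette_cell (x, i)).
apply: finite_setX => //; apply: finite_image; exact: finite_interior_cells.
Qed.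

Lemma finite_interior_edges (d n : nat) :
  finite_set [set e : edge d | interior_cell n (edge_cell e)].
Proof.
apply: (@sub_finite_set _ _ ((fst @` [set c : cell d | interior_cell n c])
  `*` setT)).
  by move=> [x i] /= H; split => //; exists (edge_cell (x, i)).
apply: finite_setX => //; apply: finite_image; exact: finite_interior_cells.
Qed.

Lemma finite_box_dual_vertices (d n : nat) :
  finite_set [set x : vertex d | dual_vertex_in_box n x].
Proof.
apply: sub_finite_set (finite_box_vertices d n).
move=> x /= /forallP xn; apply/forallP => i; have /= /andP[-> /= xi] := xn i.
by rewrite finset.in_set0 addr0; apply: le_trans xi; rewrite lerDl.
Qed.

Definition interior_plaquettes (d n : nat) : {fset plaquette d} :=
  fset_set [set c : plaquette d | interior_cell n (plaquette_cell c)].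

Definition interior_edges (d n : nat) : {fset edge d} :=
  fset_set [set e : edge d | interior_cell n (edge_cell e)].

(* Expectation and probability for the law on the subsets of A proportional to
   the weight w. *)
Definition fin_mean (R : realType) (T : choiceType) (A : {fset T})
    (w : {fset T} -> R) (f : {fset T} -> R) : R :=
  (\sum_(P <- fpowerset A) w P * f P) / (\sum_(P <- fpowerset A) w P).

Definition fin_prob (R : realType) (T : choiceType) (A : {fset T})
    (w : {fset T} -> R) (V : set {fset T}) : R :=
  fin_mean A w (\1_V).

Definition dual_param (R : realType) (p q : R) : R :=
  (1 - p) * q / ((1 - p) * q + p).

Definition boundary_condition (d n : nat) (xi : set (plaquette d)) : Prop :=
  forall c, xi c -> ~~ in_box n (plaquette_cell c) \/ in_bdbox n (plaquette_cell c).

(* The dual graph Q^xi; its vertices are all the dual vertices. *)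
Definition dual_graph (d n : nat) (xi : set (plaquette d))
    (P : {fset plaquette d}) : set (edge d) :=
  @dual_edge d @` ([set` (interior_plaquettes d n `\` P)%fset] `|`
    [set c | (~~ in_box n (plaquette_cell c) \/ in_bdbox n (plaquette_cell c))
             /\ ~ xi c]).

Definition prcm_weight (R : realType) (d n : nat) (p q : R)
    (xi : set (plaquette d)) (P : {fset plaquette d}) : R :=
  let ps := dual_param p q in
  ps ^+ #|` (interior_plaquettes d n `\` P)%fset| * (1 - ps) ^+ #|` P| *
  q ^+ ncomponents (dual_graph n xi P) [set x | dual_vertex_in_box n x].

Definition prcm_mean (R : realType) (d n : nat) (p q : R)
    (xi : set (plaquette d)) (f : {fset plaquette d} -> R) : R :=
  fin_mean (interior_plaquettes d n) (prcm_weight n p q xi) f.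

Definition prcm_prob (R : realType) (d n : nat) (p q : R)
    (xi : set (plaquette d)) (V : set {fset plaquette d}) : R :=
  fin_prob (interior_plaquettes d n) (prcm_weight n p q xi) V.

(* Configurations of plaquettes of Z^d, with the product topology of the
   discrete topologies and its Borel sigma-algebra. *)
Definition config (d : nat) := prod_topology (fun _ : plaquette d => bool).

Definition borel_config (d : nat) := g_sigma_algebraType (@open (config d)).

Definition fset_config (d : nat) (P : {fset plaquette d}) : config d :=
  fun c => c \in P.

(* Weak limits.  The test functions need not be assumed bounded, since
   [config d] is compact. *)
Definition infinite_volume_measure (R : realType) (d : nat) (p q : R)
    (mu : probability (borel_config d) R) : Prop :=
  exists xi : nat -> set (plaquette d),
    (forall n, boundary_condition n (xi n)) /\
    forall f : config d -> R, continuous f ->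
      prcm_mean n p q (xi n) (f \o @fset_config d) @[n --> \oo]
        --> (\int[mu]_w f w)%R.

Definition unique_infinite_volume (R : realType) (d : nat) (p q : R) : Prop :=
  exists mu : probability (borel_config d) R,
    infinite_volume_measure p q mu /\
    forall nu : probability (borel_config d) R,
      infinite_volume_measure p q nu ->
      forall A : set (borel_config d), measurable A -> nu A = mu A.

Inductive coefficients : Type :=
  | Integers
  | IntegersMod (m : nat) of (2 <= m)%N.

Definition coef_ring (k : coefficients) : comNzRingType :=
  match k with
  | Integers => int
  | IntegersMod m _ => 'Z_m
  end.

(* A j-chain is a function supported on the cells (x, S) with #|S| = j. *)
Definition chain (A : nzRingType) (d : nat) := cell d -> A.

(* The boundary of the oriented cube (x, S) is the sum over i in S of
   (-1)^#{k in S | k < i} ((x + e_i, S \ i) - (x, S \ i)); the formula below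
   collects the coefficient of the cell c in the boundary of f. *)
Definition chain_boundary (A : nzRingType) (d : nat) (f : chain A d) : chain A d :=
  fun c => \sum_(i : 'I_d | i \notin c.2)
    (-1) ^+ #|[set k in c.2 | (k < i)%N]%SET| *
    (f (c.1 - unit_vector i, i |: c.2)%SET - f (c.1, i |: c.2)%SET).

Definition null_homologous (A : nzRingType) (d : nat) (P : {fset plaquette d})
    (g : chain A d) : Prop :=
  exists f : chain A d,
    (forall c, f c != 0 -> exists2 a, a \in P & c = plaquette_cell a) /\
    chain_boundary f =1 g.

Definition last_dir (d : nat) (i : 'I_d) : bool := i.+1 == d.

(* [-N, N]^(d-1) x {0} as a (d-1)-chain. *)
Definition disk (A : nzRingType) (d N : nat) : chain A d :=
  fun c => (in_box N c &&
    [exists i, [&& last_dir i, c.1 i == 0 & c.2 == (~: [set i])%SET]])%:R.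

(* Its boundary, the fundamental cycle of the boundary of [-N, N]^(d-1). *)
Definition gamma (A : nzRingType) (d N : nat) : chain A d :=
  chain_boundary (@disk A d N).

Definition wilson_event (k : coefficients) (d N : nat) : set {fset plaquette d} :=
  [set P | null_homologous P (@gamma (coef_ring k) d N)].

Definition is_wilson_tension (R : realType) (k : coefficients) (d : nat)
    (p q tau : R) : Prop :=
  - ln (@prcm_prob R d N p q set0 (@wilson_event k d N)) /
    (2 * N%:R) ^+ d.-1 @[N --> \oo] --> tau.

(* The graph Q together with the boundary of Lambda_N; its vertices are those
   of Lambda_N. *)
Definition wired_graph (d N : nat) (Q : {fset edge d}) : set (edge d) :=
  [set` Q] `|` [set e | in_bdbox N (edge_cell e)].

Definition wired_rcm_weight (R : realType) (d N : nat) (p q : R)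
    (Q : {fset edge d}) : R :=
  p ^+ #|` Q| * (1 - p) ^+ (#|` interior_edges d N| - #|` Q|) *
  q ^+ ncomponents (wired_graph N Q) [set x | vertex_in_box N x].

Definition wired_rcm_prob (R : realType) (d N : nat) (p q : R)
    (V : set {fset edge d}) : R :=
  fin_prob (interior_edges d N) (wired_rcm_weight N p q) V.

Definition upper_boundary (d N : nat) : set (vertex d) :=
  [set x | vertex_in_bdbox N x && [exists i, last_dir i && (0 < x i)]].

Definition lower_boundary (d N : nat) : set (vertex d) :=
  [set x | vertex_in_bdbox N x && [exists i, last_dir i && (x i < 0)]].

Definition disconnection_event (d N : nat) : set {fset edge d} :=
  [set Q | ~ exists x y, [/\ @upper_boundary d N x, @lower_boundary d N y
                           & joined [set` Q] x y]].

Definition is_surface_tension (R : realType) (d : nat) (p q tau : R) : Prop :=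
  - ln (@wired_rcm_prob R d N p q (@disconnection_event d N)) /
    (2 * N%:R) ^+ d.-1 @[N --> \oo] --> tau.

(* Main.v *)
Require Import Defs.
From mathcomp Require Import all_boot all_order all_algebra.
From mathcomp Require Import finmap.
From mathcomp Require Import all_classical all_reals all_analysis.
From mathcomp Require Import zify lra.
Import Order.TTheory GRing.Theory Num.Theory.
Import numFieldNormedType.Exports.

Set Implicit Arguments.
Unset Strict Implicit.
Unset Printing Implicit Defensive.

Local Open Scope classical_set_scope.
Local Open Scope ring_scope.

(** Both tensions measure the cost of the same kind of event in the same kind of
    model.  For a finite set [E] of lattice edges let [fk_prob E] be the
    random-cluster measure on the subsets of [E] in which all the edges outside
    of [E] count as open, and let [cut E] be the event that no open path in [E]
    joins the part of the boundary of [E] at height at least 0 to the part at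
    negative height.

    The free plaquette measure on the cube is such a measure on the dual edges
    crossing the interior plaquettes, because the dual edges crossing the other
    plaquettes are all open.  There the Wilson loop event is exactly the cut
    ([null_homologous_cut]).  If the cut occurs, the set of dual vertices joined
    to the upper side is a chain whose boundary turns the flat disk into a
    filling by plaquettes of the configuration.  Conversely the difference
    between a filling and the disk is a closed 1-form on the dual lattice with
    finite support; its potential would jump along an open path from one side
    to the other.  This works over any ring of coefficients with [1 != 0].

    The wired measure on the cube is also such a measure, since retracting the
    lattice onto the cube shows that opening everything outside amounts to
    wiring the boundary ([joined_wired]).  Its disconnection event contains the
    cut, and the two differ only by what happens at boundary vertices of height
    exactly zero, that is at O(N^(d-2)) edges.

    The measure on a subset of [E] is the measure on [E] conditioned on the
    remaining edges being open.  By the FKG inequality, which needs [1 <= q], a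
    decreasing event becomes likelier as the region grows, and decreasing events
    are positively correlated.  Moreover cuts of disjoint regions glue to a cut
    of the union ([cut_glue]).  So [cost E], which is minus the logarithm of the
    probability of the cut, is subadditive over disjoint unions.  A single
    edge costs at most [- ln (1 - p)], and nothing unless it crosses height zero.
    Hence the [excess], which is the cost minus [- ln (1 - p)] per crossing edge,
    is subadditive, nonpositive, and decreasing in the region.

    Tiling large boxes by small ones gives the limit of the excess of the dual
    boxes per unit of area ([cvg_tiling]).  The interior edges of the cube of
    radius [N] lie between the dual boxes of radius [N - 1] and [N + 1], so by
    monotonicity their excess has the same limit, and the crossing edges contribute
    asymptotically the same area in both cases. *)

(** * Correlation inequalities for laws on the subsets of a finite set *)

Lemma sum_fpowerset_fset1U (V : nmodType) (T : choiceType) (x : T)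
    (A : {fset T}) (F : {fset T} -> V) : x \notin A ->
  \sum_(P <- fpowerset (x |` A)%fset) F P =
  \sum_(P <- fpowerset A) (F P + F (x |` P)%fset).
Proof.
move=> xA; have xP P : P \in fpowerset A -> x \notin P.
  by rewrite fpowersetE => /fsubsetP PA; apply: contra xA => /PA.
rewrite big_split /= -[X in _ = _ + X](big_map (fun P => x |` P)%fset xpredT F).
rewrite -big_cat /=; apply: perm_big; apply: uniq_perm => [||P].
- exact: fset_uniq.
- rewrite cat_uniq fset_uniq /= map_inj_in_uniq ?fset_uniq ?andbT.
    apply/hasPn => P /mapP[S _ ->]; apply/negP => /xP.
    by rewrite fset1U1.
  by move=> P S /xP xnP /xP xnS PS; rewrite -(fsetU1K xnP) PS fsetU1K.
rewrite mem_cat !fpowersetE; apply/idP/orP => [PxA|[PA|]].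
- have [xinP|xnP] := boolP (x \in P); [right|left].
    apply/mapP; exists (P `\ x)%fset; last by rewrite fsetD1K.
    by rewrite fpowersetE fsubDset.
  by rewrite -(mem_fsetD1 xnP) fsubDset.
- exact: fsubset_trans PA (fsubsetU1 _ _).
- by move=> /mapP[S]; rewrite fpowersetE => SA ->; exact: fsetUS.
Qed.

(** The case of a one-element ground set.  Only the mixed products are not
    bounded term by term: with [u = a0 b1], [v = a1 b0] and [w = c1 e0] the other
    mixed product is at least [u v / w], and [u + v <= w + u v / w] because
    [u, v <= w]. *)
Lemma four_functions_bool (R : realDomainType) (a0 a1 b0 b1 c0 c1 e0 e1 : R) :
  0 <= a0 -> 0 <= a1 -> 0 <= b0 -> 0 <= b1 ->
  0 <= c0 -> 0 <= c1 -> 0 <= e0 -> 0 <= e1 ->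
  a0 * b0 <= c0 * e0 -> a0 * b1 <= c1 * e0 ->
  a1 * b0 <= c1 * e0 -> a1 * b1 <= c1 * e1 ->
  (a0 + a1) * (b0 + b1) <= (c0 + c1) * (e0 + e1).
Proof.
move=> a0p a1p b0p b1p c0p c1p e0p e1p h00 h01 h10 h11.
suff crossle : a0 * b1 + a1 * b0 <= c0 * e1 + c1 * e0.
  rewrite !mulrDl !mulrDr; lra.
have up : 0 <= a0 * b1 by rewrite mulr_ge0.
have vp : 0 <= a1 * b0 by rewrite mulr_ge0.
have zp : 0 <= c0 * e1 by rewrite mulr_ge0.
have uvz : (a0 * b1) * (a1 * b0) <= (c0 * e1) * (c1 * e0).
  have -> : (a0 * b1) * (a1 * b0) = (a0 * b0) * (a1 * b1) by rewrite mulrACA (mulrC b1) mulrACA.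
  have -> : (c0 * e1) * (c1 * e0) = (c0 * e0) * (c1 * e1) by rewrite mulrACA (mulrC e1) mulrACA.
  by apply: ler_pM => //; exact: mulr_ge0.
have := mulr_ge0 c1p e0p; rewrite le_eqVlt => /predU1P[w0|w0].
  by move: h01 h10; rewrite -w0 => h01 h10; lra.
move: uvz h01 h10 w0; move: (c1 * e0) (a0 * b1) (a1 * b0) (c0 * e1) up vp zp.
move=> w u v z up vp zp uvz uw vw w0; rewrite -(ler_pM2l w0); nra.
Qed.

(** The four functions theorem of Ahlswede and Daykin: summing out one element of
    the ground set preserves the hypothesis, by the one-element case. *)
Lemma four_functions (R : realDomainType) (T : choiceType) (A : {fset T})
    (a b c e : {fset T} -> R) :
  (forall P, 0 <= a P) -> (forall P, 0 <= b P) ->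
  (forall P, 0 <= c P) -> (forall P, 0 <= e P) ->
  (forall P Q, (P `<=` A)%fset -> (Q `<=` A)%fset ->
     a P * b Q <= c (P `|` Q)%fset * e (P `&` Q)%fset) ->
  (\sum_(P <- fpowerset A) a P) * (\sum_(P <- fpowerset A) b P) <=
  (\sum_(P <- fpowerset A) c P) * (\sum_(P <- fpowerset A) e P).
Proof.
elim/finSet_rect: A a b c e => A IH a b c e a_ge0 b_ge0 c_ge0 e_ge0 abce.
have [->|[x xA]] := fset_0Vmem A.
  rewrite fpowerset0 !big_seq_fset1.
  by have := abce fset0 fset0; rewrite fsetUid fsetIid; apply; exact: fsub0set.
pose B := (A `\ x)%fset; have xB : x \notin B by rewrite !inE eqxx.
have defA : A = (x |` B)%fset by rewrite fsetD1K.
have BA : (B `<` A)%fset by rewrite fproperD1.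
rewrite defA !sum_fpowerset_fset1U //; apply: (IH _ BA) => [P|P|P|P|P Q PB QB];
  try by rewrite addr_ge0.
have xPA P' : (P' `<=` B)%fset -> (x |` P' `<=` A)%fset.
  by rewrite defA => ?; exact: fsetUS.
have PA P' : (P' `<=` B)%fset -> (P' `<=` A)%fset.
  by move=> ?; apply: fsubset_trans (fproper_sub BA).
have xN P' : (P' `<=` B)%fset -> x \notin P'.
  by move=> /fsubsetP P'B; apply: contra xB => /P'B.
apply: four_functions_bool => //.
- exact: abce (PA _ PB) (PA _ QB).
- rewrite fsetUCA; have <- : (P `&` (x |` Q))%fset = (P `&` Q)%fset.
    by apply/fsetP => y; rewrite !inE; case: eqP => //= ->; rewrite (negPf (xN _ PB)).
  exact: abce (PA _ PB) (xPA _ QB).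
- rewrite fsetUA; have <- : ((x |` P) `&` Q)%fset = (P `&` Q)%fset.
    by apply/fsetP => y; rewrite !inE; case: eqP => //= ->; rewrite (negPf (xN _ QB)) andbF.
  exact: abce (xPA _ PB) (PA _ QB).
- have -> : (x |` (P `|` Q) = (x |` P) `|` (x |` Q))%fset.
    by rewrite fsetUACA fsetUid.
  by rewrite fsetUIr; exact: abce (xPA _ PB) (xPA _ QB).
Qed.

Lemma sum_fpowerset_bij (V : nmodType) (T U : choiceType) (A : {fset T})
    (B : {fset U}) (h : {fset T} -> {fset U}) (g : {fset U} -> {fset T})
    (F : {fset U} -> V) :
  (forall P, (P `<=` A)%fset -> (h P `<=` B)%fset) ->
  (forall P, (P `<=` B)%fset -> (g P `<=` A)%fset) ->
  (forall P, (P `<=` A)%fset -> g (h P) = P) ->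
  (forall P, (P `<=` B)%fset -> h (g P) = P) ->
  \sum_(P <- fpowerset B) F P = \sum_(P <- fpowerset A) F (h P).
Proof.
move=> hB gA gh hg; rewrite -(big_map h xpredT F); apply: perm_big.
apply: uniq_perm => [||P]; first exact: fset_uniq.
  rewrite map_inj_in_uniq ?fset_uniq // => P S; rewrite !fpowersetE => PA SA hPS.
  by rewrite -(gh _ PA) hPS gh.
rewrite fpowersetE; apply/idP/mapP => [PB|[S]].
  by exists (g P); rewrite ?hg // fpowersetE gA.
by rewrite fpowersetE => SA ->; exact: hB.
Qed.

Definition decreasing (T : choiceType) (V : set {fset T}) : Prop :=
  forall P Q : {fset T}, (P `<=` Q)%fset -> V Q -> V P.

Definition log_supermodular (R : realType) (T : choiceType) (A : {fset T})
    (w : {fset T} -> R) : Prop :=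
  forall P Q, (P `<=` A)%fset -> (Q `<=` A)%fset ->
    w P * w Q <= w (P `|` Q)%fset * w (P `&` Q)%fset.

Lemma indic_in (R : realType) (T : choiceType) (V : set T) (x : T) :
  V x -> \1_V x = 1 :> R.
Proof. by move=> Vx; rewrite indicE mem_set. Qed.

Lemma indic_notin (R : realType) (T : choiceType) (V : set T) (x : T) :
  ~ V x -> \1_V x = 0 :> R.
Proof. by move=> Vx; rewrite indicE memNset. Qed.

Lemma indic_eq (R : realType) (T U : choiceType) (V : set T) (W : set U)
    (x : T) (y : U) : (V x <-> W y) -> \1_V x = \1_W y :> R.
Proof.
move=> VW; have [Vx|Vx] := pselect (V x); first by rewrite !indic_in //; exact/VW.
by rewrite !indic_notin // => /VW.
Qed.

Lemma sum_fpowerset_gt0 (R : realType) (T : choiceType) (A : {fset T})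
    (w : {fset T} -> R) : (forall P, 0 < w P) -> 0 < \sum_(P <- fpowerset A) w P.
Proof.
move=> w_gt0; rewrite (big_fsetD1 fset0) ?fpowersetE ?fsub0set //=.
by rewrite ltr_pwDl // sumr_ge0 // => P _; exact: ltW.
Qed.

(** The FKG inequality: the intersection of the two configurations lies in both
    events, and the four functions theorem is applied to the weights restricted
    to these events. *)
Lemma fkg (R : realType) (T : choiceType) (A : {fset T}) (w : {fset T} -> R)
    (V W : set {fset T}) :
  (forall P, 0 < w P) -> log_supermodular A w ->
  decreasing V -> decreasing W ->
  fin_prob A w V * fin_prob A w W <= fin_prob A w (V `&` W).
Proof.
move=> w_gt0 wsm dV dW; have w_ge0 P : 0 <= w P by exact: ltW.
have Z_gt0 := sum_fpowerset_gt0 A w_gt0.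
rewrite /fin_prob /fin_mean mulf_div ler_pdivrMr ?mulr_gt0 //.
rewrite [leRHS]mulrA divfK ?gt_eqF // [leRHS]mulrC.
apply: four_functions => [P|P|P|P|P Q PA QA] //;
  try by rewrite mulr_ge0 // indicE ler0n.
have [VP|VP] := pselect (V P); last first.
  by rewrite (indic_notin _ VP) mulr0 mul0r !mulr_ge0 // indicE ler0n.
have [WQ|WQ] := pselect (W Q); last first.
  by rewrite (indic_notin _ WQ) !mulr0 !mulr_ge0 // indicE ler0n.
rewrite !indic_in ?mulr1 //; first exact: wsm.
by split; [apply: dV VP; exact: fsubsetIl|apply: dW WQ; exact: fsubsetIr].
Qed.

(** Conditioning on the increasing event that every element of [A `\` B] is
    present can only make a decreasing event less likely; if the weight [w]
    under this condition is proportional to [w'], the conditioned law is that of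
    [w']. *)
Lemma fin_prob_restrict (R : realType) (T : choiceType) (A B : {fset T})
    (w w' : {fset T} -> R) (K : R) (V : set {fset T}) :
  (B `<=` A)%fset ->
  (forall P, 0 < w P) -> log_supermodular A w -> 0 < K ->
  (forall P, (P `<=` B)%fset -> w (P `|` (A `\` B))%fset = K * w' P) ->
  decreasing V -> (forall P, V P <-> V (P `&` B)%fset) ->
  fin_prob B w' V <= fin_prob A w V.
Proof.
move=> BA w_gt0 wsm K_gt0 ww' dV VB; have w_ge0 P : 0 <= w P by exact: ltW.
have Z_gt0 := sum_fpowerset_gt0 A w_gt0.
pose O : set {fset T} := [set P | (A `\` B `<=` P)%fset].
have dB P : (P `<=` B)%fset -> ((P `|` (A `\` B)) `&` B = P)%fset.
  move=> /fsubsetP PB; apply/fsetP => x; rewrite !inE.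
  by have := PB x; case: (x \in P) => [->|] //; case: (x \in B); rewrite ?andbF.
have sumO (F : {fset T} -> R) : \sum_(P <- fpowerset A) F P * \1_O P =
    \sum_(P <- fpowerset B) F (P `|` (A `\` B))%fset.
  transitivity (\sum_(P <- fpowerset A | (A `\` B `<=` P)%fset) F P).
    rewrite [RHS]big_mkcond /=; apply: eq_bigr => P _; case: ifPn => OP.
      by rewrite indic_in // mulr1.
    by rewrite indic_notin ?mulr0 // => /(negP OP).
  rewrite -big_filter -(big_map (fun P => P `|` (A `\` B))%fset xpredT F).
  apply: perm_big; apply: uniq_perm => [||P].
  - by rewrite filter_uniq // fset_uniq.
  - rewrite map_inj_in_uniq ?fset_uniq // => P Q; rewrite !fpowersetE => PB QB PQ.
    by rewrite -(dB _ PB) PQ dB.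
  - rewrite mem_filter fpowersetE; apply/andP/mapP => [[OP PA]|[Q]].
      exists (P `&` B)%fset; first by rewrite fpowersetE fsubsetIr.
      apply/fsetP => x; rewrite !inE.
      have := fsubsetP OP x; have := fsubsetP PA x; rewrite !inE.
      case: (x \in P) => [-> //|_]; first by rewrite andbT orbN.
      by case: (x \in A); case: (x \in B) => //= /(_ isT).
    rewrite fpowersetE => QB ->; split; first exact: fsubsetUr.
    by rewrite fsubUset fsubsetDl (fsubset_trans QB).
have SO_gt0 : 0 < \sum_(P <- fpowerset A) w P * \1_O P.
  by rewrite sumO sum_fpowerset_gt0.
have toA (F : {fset T} -> R) : (forall P, F P = F (P `&` B)%fset) ->
    \sum_(P <- fpowerset B) w' P * F P =
    K^-1 * \sum_(P <- fpowerset A) w P * F P * \1_O P.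
  move=> FB; rewrite (sumO (fun P => w P * F P)) big_distrr /=.
  apply: eq_big_seq => P; rewrite fpowersetE => PB.
  by rewrite ww' // FB [in RHS]FB dB // (fsetIidPl PB) !mulrA mulVf ?mul1r ?gt_eqF.
have -> : fin_prob B w' V = (\sum_(P <- fpowerset A) w P * \1_V P * \1_O P) /
    (\sum_(P <- fpowerset A) w P * \1_O P).
  rewrite /fin_prob /fin_mean toA; last by move=> P; apply: indic_eq; exact: VB.
  have -> : \sum_(P <- fpowerset B) w' P =
      K^-1 * \sum_(P <- fpowerset A) w P * \1_O P.
    under eq_bigr do rewrite -[w' _]mulr1.
    by rewrite (toA (fun=> 1)) //; under eq_bigr do rewrite mulr1.
  by rewrite -mulf_div divff ?mul1r // invr_eq0 gt_eqF.
rewrite /fin_prob /fin_mean ler_pdivrMr // mulrAC ler_pdivlMr // [leRHS]mulrC.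
apply: four_functions => [P|P|P|P|P Q PA QA] //;
  try by rewrite ?mulr_ge0 // indicE ler0n.
have [VP|VP] := pselect (V P); last first.
  by rewrite (indic_notin _ VP) mulr0 !mul0r !mulr_ge0 // indicE ler0n.
have [OP|OP] := pselect (O P); last first.
  by rewrite (indic_notin _ OP) mulr0 mul0r !mulr_ge0 // indicE ler0n.
rewrite !indic_in ?mulr1 //; first exact: wsm.
- by apply: dV VP; exact: fsubsetIl.
- by apply: fsubset_trans OP _; exact: fsubsetUl.
Qed.

Lemma fin_prob_bij (R : realType) (T U : choiceType) (A : {fset T})
    (B : {fset U}) (h : {fset T} -> {fset U}) (g : {fset U} -> {fset T})
    (w : {fset T} -> R) (w' : {fset U} -> R) (K : R)
    (V : set {fset T}) (V' : set {fset U}) :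
  (forall P, (P `<=` A)%fset -> (h P `<=` B)%fset) ->
  (forall P, (P `<=` B)%fset -> (g P `<=` A)%fset) ->
  (forall P, (P `<=` A)%fset -> g (h P) = P) ->
  (forall P, (P `<=` B)%fset -> h (g P) = P) ->
  K != 0 -> (forall P, (P `<=` A)%fset -> w' (h P) = K * w P) ->
  (forall P, (P `<=` A)%fset -> (V' (h P) <-> V P)) ->
  fin_prob B w' V' = fin_prob A w V.
Proof.
move=> hB gA gh hg K0 w'h V'h; rewrite /fin_prob /fin_mean.
rewrite !(sum_fpowerset_bij _ hB gA gh hg).
rewrite (_ : \sum_(P <- fpowerset A) w' (h P) * _ =
             K * \sum_(P <- fpowerset A) w P * \1_V P); last first.
  rewrite big_distrr /=; apply: eq_big_seq => P; rewrite fpowersetE => PA.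
  by rewrite w'h // (indic_eq _ (V'h _ PA)) mulrA.
rewrite (_ : \sum_(P <- fpowerset A) w' (h P) =
             K * \sum_(P <- fpowerset A) w P); last first.
  rewrite big_distrr /=; apply: eq_big_seq => P; rewrite fpowersetE => PA.
  by rewrite w'h.
by rewrite -mulf_div divff // mul1r.
Qed.

Lemma fin_prob_same (R : realType) (T : choiceType) (A : {fset T})
    (w w' : {fset T} -> R) (K : R) (V V' : set {fset T}) :
  K != 0 -> (forall P, (P `<=` A)%fset -> w' P = K * w P) ->
  (forall P, (P `<=` A)%fset -> (V' P <-> V P)) ->
  fin_prob A w' V' = fin_prob A w V.
Proof. by move=> K0 w'w V'V; apply: (@fin_prob_bij _ _ _ _ _ id id _ _ K). Qed.

Lemma fin_prob_le (R : realType) (T : choiceType) (A : {fset T})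
    (w : {fset T} -> R) (V W : set {fset T}) :
  (forall P, 0 < w P) ->
  (forall P, (P `<=` A)%fset -> V P -> W P) ->
  fin_prob A w V <= fin_prob A w W.
Proof.
move=> w_gt0 VW; rewrite /fin_prob /fin_mean ler_pM2r ?invr_gt0 ?sum_fpowerset_gt0 //.
rewrite big_seq [leRHS]big_seq; apply: ler_sum => P; rewrite fpowersetE => PA.
rewrite ler_pM2l //; have [VP|VP] := pselect (V P).
  by rewrite !indic_in //; exact: VW.
by rewrite (indic_notin _ VP) indicE ler0n.
Qed.

Lemma fin_prob_gt0 (R : realType) (T : choiceType) (A : {fset T})
    (w : {fset T} -> R) (V : set {fset T}) :
  (forall P, 0 < w P) -> V fset0 -> 0 < fin_prob A w V.
Proof.
move=> w_gt0 V0; rewrite /fin_prob /fin_mean divr_gt0 //; last exact: sum_fpowerset_gt0.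
rewrite (big_fsetD1 fset0) ?fpowersetE ?fsub0set //= indic_in // mulr1.
rewrite ltr_pwDl // sumr_ge0 // => P _.
by apply: mulr_ge0; [exact: ltW|rewrite indicE ler0n].
Qed.

Lemma fin_prob_le1 (R : realType) (T : choiceType) (A : {fset T})
    (w : {fset T} -> R) (V : set {fset T}) :
  (forall P, 0 < w P) -> fin_prob A w V <= 1.
Proof.
move=> w_gt0; rewrite /fin_prob /fin_mean ler_pdivrMr ?sum_fpowerset_gt0 // mul1r.
apply: ler_sum => P _; apply: ler_piMr; first exact: ltW.
by rewrite indicE -[leRHS]/(1%:R) ler_nat leq_b1.
Qed.

(** * Paths and connected components *)

Definition edge_tip (d : nat) (e : edge d) : vertex d := e.1 + unit_vector e.2.

Definition touches (d : nat) (E : set (edge d)) (v : vertex d) : Prop :=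
  exists2 e, E e & v = e.1 \/ v = edge_tip e.

Section Joined.
Variable d : nat.
Implicit Types (E G : set (edge d)) (x y z : vertex d) (e : edge d).

Lemma joined_ind E (I : vertex d -> Prop) x y :
  (forall e, E e -> (I e.1 <-> I (edge_tip e))) -> joined E x y -> I x -> I y.
Proof.
move=> stepI [s [Es <-]]; elim: s x Es => //= z s IH x /andP[/asboolP[i xz] zs] Ix.
apply: IH zs _; case: xz => -[Ee xz].
  by have /= := stepI _ Ee; rewrite /edge_tip xz /= => <-.
by have /= := stepI _ Ee; rewrite /edge_tip /= -xz => ->.
Qed.

Lemma joined_refl E x : joined E x x.
Proof. by exists [::]. Qed.

Lemma joined_trans E x y z : joined E x y -> joined E y z -> joined E x z.
Proof.
move=> [s [Es sy]] [t [Et tz]]; exists (s ++ t).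
by rewrite cat_path last_cat Es sy Et.
Qed.

Lemma joined_edge E e : E e -> joined E e.1 (edge_tip e).
Proof.
case: e => v i Ee; exists [:: edge_tip (v, i)]; split=> //=; rewrite andbT.
by apply/asboolP; exists i; left.
Qed.

Lemma joined_edgeV E e : E e -> joined E (edge_tip e) e.1.
Proof.
case: e => v i Ee; exists [:: v]; split=> //=; rewrite andbT.
by apply/asboolP; exists i; right.
Qed.

Lemma joined_sym E x y : joined E x y -> joined E y x.
Proof.
move=> xy; apply: (@joined_ind E (fun z => joined E z x) x y) => //.
  move=> e Ee; split; apply: joined_trans; first exact: joined_edgeV.
  exact: joined_edge.
exact: joined_refl.
Qed.

Lemma joined_sub E G x y :
  (forall e, E e -> joined G e.1 (edge_tip e)) -> joined E x y -> joined G x y.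
Proof.
move=> EG xy; apply: (@joined_ind E (joined G x) x y) => //; last exact: joined_refl.
move=> e /EG eG; split=> h; apply: joined_trans h _ => //; exact: joined_sym.
Qed.

Lemma joined_mono E G x y : E `<=` G -> joined E x y -> joined G x y.
Proof. by move=> EG; apply: joined_sub => e /EG; exact: joined_edge. Qed.

Lemma joined_touches E x y : joined E x y -> x = y \/ touches E y.
Proof.
move=> xy; apply: (@joined_ind E (fun z => x = z \/ touches E z) x y) => //; last by left.
by move=> e Ee; split=> _; right; exists e => //; [right|left].
Qed.

Lemma joined_add G e x y : joined (e |` G) x y ->
  [\/ joined G x y, joined G x e.1 /\ joined G (edge_tip e) y
    | joined G x (edge_tip e) /\ joined G e.1 y].
Proof.
move=> xy; have G0 := joined_refl G; have Gt := @joined_trans G.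
pose I z := [\/ joined G x z, joined G x e.1 /\ joined G (edge_tip e) z
               | joined G x (edge_tip e) /\ joined G e.1 z].
apply: (@joined_ind (e |` G) I x y) => //; last by constructor 1.
move=> f [->|Gf].
  by split=> -[h|[h _]|[h _]]; (try by constructor 1);
    (try by constructor 2); constructor 3.
have ff := joined_edge Gf; have ff' := joined_edgeV Gf.
split=> -[h|[h h']|[h h']].
- by constructor 1; exact: Gt ff.
- by constructor 2; split=> //; exact: Gt ff.
- by constructor 3; split=> //; exact: Gt ff.
- by constructor 1; exact: Gt ff'.
- by constructor 2; split=> //; exact: Gt ff'.
- by constructor 3; split=> //; exact: Gt ff'.
Qed.

Lemma joined_add_joined G e x y : joined G e.1 (edge_tip e) ->
  joined (e |` G) x y -> joined G x y.
Proof.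
by move=> Ge; apply: joined_sub => f [->//|]; exact: joined_edge.
Qed.

Lemma eq_component G x y : component G x = component G y <-> joined G x y.
Proof.
split=> [xy|xy]; first by rewrite -[joined G x y]/(component G x y) xy; exact: joined_refl.
apply/seteqP; split=> z /=; apply: joined_trans => //; exact: joined_sym.
Qed.

End Joined.

(** If [g] separates at least the points that [f] separates then [f] factors
    through [g]. *)
Lemma leq_card_imfset_factor (T U W : choiceType) (X : {fset T}) (f : T -> U)
    (g : T -> W) :
  (forall x y, x \in X -> y \in X -> g x = g y -> f x = f y) ->
  (#|` [fset f x | x in X]%fset| <= #|` [fset g x | x in X]%fset|)%N.
Proof.
move=> gf; have [->|[x0 x0X]] := fset_0Vmem X; first by rewrite !imfset0 cardfs0.
pose h w := f (xget x0 [set x | x \in X /\ g x = w]).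
suff -> : [fset f x | x in X]%fset = [fset h w | w in [fset g x | x in X]]%fset.
  exact: leq_imfset_card.
have hg x : x \in X -> h (g x) = f x.
  move=> xX; rewrite /h; case: xgetP => [y _ [yX gyx]|/(_ x)]; first exact: gf.
  by case.
apply/fsetP => u; apply/imfsetP/imfsetP => -[x /=].
  by move=> xX ->; exists (g x); rewrite ?hg //= in_imfset.
by move=> /imfsetP[y /= yX ->] ->; exists y => //; exact: hg.
Qed.

Lemma card_imfset_kernel (T U W : choiceType) (X : {fset T}) (f : T -> U)
    (g : T -> W) :
  (forall x y, x \in X -> y \in X -> (f x = f y <-> g x = g y)) ->
  #|` [fset f x | x in X]%fset| = #|` [fset g x | x in X]%fset|.
Proof.
move=> fg; apply/eqP; rewrite eqn_leq; apply/andP.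
by split; apply: leq_card_imfset_factor => x y xX yX /(fg _ _ xX yX).
Qed.

Section Ncomponents.
Variables (d : nat) (V : set (vertex d)).
Hypothesis finV : finite_set V.
Implicit Types (G : set (edge d)) (e : edge d).

Lemma ncomponentsE G :
  ncomponents G V = #|` [fset component G x | x in fset_set V]%fset|.
Proof. by rewrite /ncomponents fset_set_image. Qed.

Lemma in_fset_setP x : reflect (V x) (x \in fset_set V).
Proof. by rewrite in_fset_set //; apply: (iffP idP); rewrite in_setE. Qed.

Lemma eq_ncomponents G G' :
  (forall x y, V x -> V y -> (joined G x y <-> joined G' x y)) ->
  ncomponents G V = ncomponents G' V.
Proof.
move=> GG'; rewrite !ncomponentsE; apply: card_imfset_kernel => x y.
by move=> /in_fset_setP Vx /in_fset_setP Vy; rewrite !eq_component; exact: GG'.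
Qed.

(** Components are counted before and after by the vertices that are not joined
    to the tip of [e]: if [e] merges two components, removing that of the tip
    leaves one representative class for each component of the larger graph. *)
Lemma ncomponents_add G e : V e.1 -> V (edge_tip e) ->
  ncomponents G V =
  (ncomponents (e |` G) V + ~~ `[< joined G e.1 (edge_tip e) >])%N.
Proof.
move=> Ve1 Ve2; case: asboolP => /= [Ge|Ge].
  rewrite addn0; apply: eq_ncomponents => x y _ _; split; last exact: joined_add_joined.
  by apply: joined_mono => f; right.
have subG : G `<=` e |` G by move=> f; right.
have G0 := joined_refl G; have Gt := @joined_trans _ G; have Gs := @joined_sym _ G.
pose X := fset_set V; pose X' := [fset x in X | ~~ `[< joined G (edge_tip e) x >]]%fset.
have X'P x : x \in X' -> V x /\ ~ joined G (edge_tip e) x.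
  by rewrite !inE /= => /andP[/in_fset_setP Vx /asboolPn].
have inX' x : V x -> ~ joined G (edge_tip e) x -> x \in X'.
  by move=> /in_fset_setP Vx nx; rewrite !inE /= Vx; exact/asboolPn.
rewrite !ncomponentsE.
have -> : [fset component G x | x in X]%fset =
    (component G (edge_tip e) |` [fset component G x | x in X'])%fset.
  apply/fsetP => C; rewrite in_fset1U; apply/imfsetP/orP => [[x /= /in_fset_setP Vx ->]|].
    have [Gx|Gx] := pselect (joined G (edge_tip e) x).
      by left; apply/eqP/eq_component; exact: Gs.
    by right; apply/imfsetP; exists x => //; exact: inX'.
  case=> [/eqP ->|/imfsetP[x /= /X'P[Vx _] ->]]; last by exists x => //; exact/in_fset_setP.
  by exists (edge_tip e) => //; exact/in_fset_setP.
rewrite cardfsU1 (_ : _ \notin _); last first.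
  by apply/imfsetP => -[x /= /X'P[_ nx] /eq_component].
rewrite addn1 add1n; congr _.+1.
have -> : [fset component (e |` G) x | x in X]%fset =
    [fset component (e |` G) x | x in X']%fset.
  apply/fsetP => C; apply/imfsetP/imfsetP => -[x /=].
    move=> /in_fset_setP Vx ->; have [Gx|Gx] := pselect (joined G (edge_tip e) x).
      exists e.1; first by apply: inX' => // /Gs.
      apply/eq_component/joined_sym; apply: joined_trans (joined_mono subG Gx).
      by apply: joined_edge; left.
    by exists x => //; exact: inX'.
  by move=> /X'P[Vx _] ->; exists x => //; exact/in_fset_setP.
apply: card_imfset_kernel => x y /X'P[_ nx] /X'P[_ ny]; rewrite !eq_component.
split; first exact: joined_mono.
by move=> /joined_add[//|[_ /ny]|[/Gs /nx]].
Qed.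

End Ncomponents.

(** * The random-cluster measure with everything open outside *)

Lemma fset_ind_add (T : choiceType) (P : {fset T} -> Prop) :
  P fset0 -> (forall x A, x \notin A -> P A -> P (x |` A)%fset) ->
  forall A, P A.
Proof.
move=> P0 PU; elim/finSet_rect => A IH.
have [->//|[x xA]] := fset_0Vmem A.
rewrite -(fsetD1K xA); apply: PU; first by rewrite !inE eqxx.
by apply: IH; exact: fproperD1.
Qed.

Section RandomCluster.
Variables (R : realType) (d : nat) (p q : R).
Hypotheses (p_gt0 : 0 < p) (p_lt1 : p < 1) (q_ge1 : 1 <= q).
Implicit Types (E Q P : {fset edge d}) (e : edge d) (V : set (vertex d)).

Definition open_outside E Q : set (edge d) := [set` Q] `|` ~` [set` E].

Definition edge_ends E : set (vertex d) := [set v | touches [set` E] v].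

Definition fk_weight E V Q : R :=
  p ^+ #|` Q| * (1 - p) ^+ #|` (E `\` Q)%fset| *
  q ^+ ncomponents (open_outside E Q) V.

(** Components are counted by the ends of the edges of [E], but any finite set
    of vertices containing them defines the same measure, see [fk_weight_proportional]. *)
Definition fk_prob E (D : set {fset edge d}) : R :=
  fin_prob E (fk_weight E (edge_ends E)) D.

Let q_gt0 : 0 < q. Proof. exact: lt_le_trans q_ge1. Qed.

Let p'_gt0 : 0 < 1 - p. Proof. by rewrite subr_gt0. Qed.

Lemma finite_edge_ends E : finite_set (edge_ends E).
Proof.
apply: (@sub_finite_set _ _ ((fst @` [set` E]) `|` (@edge_tip d @` [set` E]))).
  by move=> v [e Ee [->|->]]; [left|right]; exists e.
by rewrite finite_setU; split; apply: finite_image; exact: finite_fset.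
Qed.

Lemma edge_ends1 E e : e \in E -> edge_ends E e.1.
Proof. by move=> Ee; exists e => //; left. Qed.

Lemma edge_ends2 E e : e \in E -> edge_ends E (edge_tip e).
Proof. by move=> Ee; exists e => //; right. Qed.

Lemma open_outside_add E Q e :
  open_outside E (e |` Q)%fset = e |` open_outside E Q.
Proof. by rewrite /open_outside set_fsetU1 setUA. Qed.

Lemma fk_weight_gt0 E V Q : 0 < fk_weight E V Q.
Proof. by rewrite /fk_weight !mulr_gt0 ?exprn_gt0. Qed.

Section Kappa.
Variables (E : {fset edge d}).

Lemma kappa_add V Q e : finite_set V -> edge_ends E `<=` V -> e \in E ->
  ncomponents (open_outside E Q) V = (ncomponents (open_outside E (e |` Q)%fset) V +
    ~~ `[< joined (open_outside E Q) e.1 (edge_tip e) >])%N.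
Proof.
move=> finV EV eE; rewrite open_outside_add; apply: ncomponents_add => //; apply: EV.
  exact: edge_ends1.
exact: edge_ends2.
Qed.

(** The number of components lost by opening [Q] is a rank of [Q], which does
    not see the vertex set in which components are counted. *)
Lemma kappa_rank Q : (Q `<=` E)%fset -> exists r, forall V, finite_set V ->
  edge_ends E `<=` V ->
  ncomponents (open_outside E fset0) V = (ncomponents (open_outside E Q) V + r)%N.
Proof.
elim/fset_ind_add: Q => [|e Q eQ IH]; first by exists 0 => V _ _; rewrite addn0.
rewrite fsubUset fsub1set => /andP[eE /IH[r rP]].
exists (~~ `[< joined (open_outside E Q) e.1 (edge_tip e) >] + r)%N => V finV EV.
by rewrite rP // (kappa_add Q finV EV eE) addnA.
Qed.

Lemma kappa_mono V Q : finite_set V -> edge_ends E `<=` V -> (Q `<=` E)%fset ->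
  (ncomponents (open_outside E Q) V <= ncomponents (open_outside E fset0) V)%N.
Proof.
by move=> finV EV /kappa_rank[r /(_ _ finV EV) ->]; rewrite leq_addr.
Qed.

(** Opening an edge merges two components of the smaller configuration as soon
    as it merges two components of the larger one. *)
Lemma kappa_supermodular V Q P D : finite_set V -> edge_ends E `<=` V ->
  (Q `<=` P)%fset -> (D `<=` E)%fset ->
  (ncomponents (open_outside E P) V + ncomponents (open_outside E (Q `|` D)%fset) V <=
   ncomponents (open_outside E Q) V + ncomponents (open_outside E (P `|` D)%fset) V)%N.
Proof.
move=> finV EV QP; elim/fset_ind_add: D => [|e D eD IH].
  by rewrite !fsetU0 addnC.
rewrite fsubUset fsub1set => /andP[eE /IH le].
rewrite !(fsetUCA _ [fset e]%fset); move: le.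
rewrite (kappa_add (Q `|` D)%fset finV EV eE) (kappa_add (P `|` D)%fset finV EV eE).
have : (`[< joined (open_outside E (Q `|` D)%fset) e.1 (edge_tip e) >] <=
        `[< joined (open_outside E (P `|` D)%fset) e.1 (edge_tip e) >])%N.
  case: asboolP => // QDe; rewrite asboolT //; apply: joined_mono QDe.
  move=> f [/= fQD|nf]; [left|by right] => /=.
  by apply: fsubsetP fQD; exact: fsetSU.
by case: `[< _ >]; case: `[< _ >] => //=; lia.
Qed.

End Kappa.

Lemma fk_weight_supermodular E V : finite_set V -> edge_ends E `<=` V ->
  log_supermodular E (fk_weight E V).
Proof.
move=> finV EV P Q PE QE; rewrite /fk_weight.
rewrite mulrACA [in leRHS]mulrACA; apply: ler_pM.
- by rewrite !mulr_ge0 // exprn_ge0 // ltW.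
- by rewrite mulr_ge0 // exprn_ge0 // ltW.
- rewrite mulrACA [leRHS]mulrACA -!exprD cardfsUI fsetDUr fsetDIr.
  by rewrite [(#|` (_ `&` _)%fset| + _)%N]addnC cardfsUI.
- rewrite -!exprD ler_weXn2l //.
  have := kappa_supermodular finV EV (fsubsetIr P Q) PE.
  by rewrite (fsetUidPr _ _ (fsubsetIl P Q)) [(Q `|` P)%fset]fsetUC; lia.
Qed.

Lemma fk_weight_proportional E V : finite_set V -> edge_ends E `<=` V ->
  exists2 K : R, K != 0 & forall Q, (Q `<=` E)%fset ->
    fk_weight E V Q = K * fk_weight E (edge_ends E) Q.
Proof.
move=> finV EV; have finE := finite_edge_ends E.
have qn n : q ^+ n != 0 by rewrite expf_neq0 // gt_eqF.
exists (q ^+ ncomponents (open_outside E fset0) V /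
        q ^+ ncomponents (open_outside E fset0) (edge_ends E)).
  by rewrite mulf_neq0 // invr_neq0.
move=> Q /kappa_rank[r rP]; rewrite /fk_weight (rP _ finV EV) (rP _ finE) //.
rewrite [RHS]mulrCA; congr (_ * _); rewrite !exprD -mulf_div divff // mulr1.
by rewrite divfK.
Qed.

Lemma fk_prob_fkg E D D' : decreasing D -> decreasing D' ->
  fk_prob E D * fk_prob E D' <= fk_prob E (D `&` D').
Proof.
apply: fkg; first by move=> ?; exact: fk_weight_gt0.
by apply: fk_weight_supermodular => //; exact: finite_edge_ends.
Qed.

(** Since everything outside of the ground set counts as open, the measure on
    a smaller set of edges is the measure on the larger one conditioned on the
    difference being open. *)
Lemma fk_prob_mono E E' D : (E' `<=` E)%fset -> decreasing D ->
  (forall Q, D Q <-> D (Q `&` E')%fset) -> fk_prob E' D <= fk_prob E D.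
Proof.
move=> E'E decD DE'; have finE := finite_edge_ends E.
have E'V : edge_ends E' `<=` edge_ends E.
  by move=> v [e /= eE' h]; exists e => //=; exact: (fsubsetP E'E).
have [K K0 KP] := fk_weight_proportional finE E'V.
rewrite /fk_prob -(fin_prob_same K0 KP (V' := D) (V := D)) //.
apply: (@fin_prob_restrict _ _ _ _ _ _ (p ^+ #|` (E `\` E')%fset|)) => //.
- by move=> ?; exact: fk_weight_gt0.
- exact: fk_weight_supermodular.
- exact: exprn_gt0.
move=> Q QE'; rewrite /fk_weight.
have <- : open_outside E' Q = open_outside E (Q `|` (E `\` E'))%fset.
  rewrite /open_outside; apply/seteqP; split=> e /=; rewrite !inE.
    case=> [-> //|/negP eE']; first by left.
    by case: (boolP (e \in E)) => eE; [left; rewrite eE'|right]; rewrite ?orbT.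
  move=> [/orP[eQ|/andP[/negP eE' _]]|/negP eE]; [by left|by right|right].
  by apply/negP; apply: contra eE; exact: (fsubsetP E'E).
rewrite !mulrA; congr (_ * _ * _).
  rewrite -exprD; congr (_ ^+ _); rewrite cardfsU addnC.
  rewrite (_ : (Q `&` _)%fset = fset0) ?cardfs0 ?subn0 //; apply/fsetP => e; rewrite !inE.
  by have := fsubsetP QE' e; case: (e \in Q) => //= ->.
congr (_ ^+ #|` _|); apply/fsetP => e; rewrite !inE.
have := fsubsetP E'E e; case: (e \in E') => [->|_] //=.
  by rewrite orbF andbT.
by case: (e \in E); rewrite ?andbF // orbT.
Qed.

End RandomCluster.

(** * Cuts and their cost *)

Section Cut.
Variables (d : nat) (l : 'I_d).
Implicit Types (E Q F : {fset edge d}) (e : edge d) (x y v : vertex d).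

Definition boundary E : set (vertex d) := touches (~` [set` E]).

(** Only [Q `&` E] matters, so that the event makes sense in larger regions. *)
Definition cut E : set {fset edge d} :=
  [set Q | forall x y, boundary E x -> boundary E y -> 0 <= x l -> y l < 0 ->
           ~ joined [set` (Q `&` E)%fset] x y].

Definition crossing E : {fset edge d} :=
  [fset e in E | (e.2 == l) && (e.1 l == -1)]%fset.

Lemma edge_tipE e (i : 'I_d) : edge_tip e i = e.1 i + (i == e.2)%:Z.
Proof. by rewrite /edge_tip !ffunE. Qed.

Lemma cut_decreasing E : decreasing (cut E).
Proof.
move=> P Q PQ cutQ x y bx by_ x0 y0 xy; apply: (cutQ x y) => //.
by apply: joined_mono xy => e; apply: fsubsetP; exact: fsetSI.
Qed.

Lemma cut_restrict E Q : cut E Q <-> cut E (Q `&` E)%fset.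
Proof. by rewrite /cut /= -fsetIA fsetIid. Qed.

Lemma joined_fset0 x y : joined [set` (fset0 : {fset edge d})] x y -> x = y.
Proof. by move=> /joined_touches[//|[e /=]]; rewrite inE. Qed.

Lemma cut0 E : cut E fset0.
Proof.
move=> x y _ _ x0 y0; rewrite fset0I => /joined_fset0 xy.
by move: y0; rewrite -xy ltNge x0.
Qed.

(** The induction step of [cut_glue]: a path that ran inside [E2] from the upper
    side and is about to continue in [E1] is at a vertex of both boundaries, and
    still on the upper side. *)
Lemma cut_glue_step E1 E2 Q x u e : [disjoint E1 & E2]%fset ->
  cut E1 Q -> cut E2 Q ->
  e \in (Q `&` E1)%fset -> x = e.1 \/ x = edge_tip e ->
  boundary E1 u -> boundary E2 u -> 0 <= u l ->
  joined [set` (Q `&` E2)%fset] u x ->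
  [/\ boundary E1 x, boundary E2 x & 0 <= x l].
Proof.
move=> /fdisjointP dis cut1 cut2; rewrite inE => /andP[_ eE1] xe u1 u2 u0 ux.
have x2 : boundary E2 x by exists e => //=; apply/negP/dis.
have x1 : boundary E1 x.
  case: (joined_touches ux) => [<- //|[f /=]]; rewrite inE => /andP[_ fE2] xf.
  by exists f => //= fE1; move: (dis _ fE1); rewrite fE2.
split=> //; rewrite leNgt; apply/negP => x0; exact: (cut2 u x).
Qed.

(** Where a path passes from one region to the other it meets the boundary of
    both, so its pieces inside a region never change sides, and neither does
    the path. *)
Lemma cut_glue E1 E2 Q : [disjoint E1 & E2]%fset ->
  cut E1 Q -> cut E2 Q -> cut (E1 `|` E2)%fset Q.
Proof.
move=> dis cut1 cut2 x y bx by_ x0 y0 xy.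
have bU z : boundary (E1 `|` E2)%fset z -> boundary E1 z /\ boundary E2 z.
  by move=> [e /=]; rewrite inE => /negP/norP[/negP e1 /negP e2] ze; split; exists e.
(* The piece of the path that runs in the current region started at [u]. *)
pose I v := exists u, [/\ boundary E1 u, boundary E2 u, 0 <= u l &
  joined [set` (Q `&` E1)%fset] u v \/ joined [set` (Q `&` E2)%fset] u v].
suff : I y.
  have [y1 y2] := bU _ by_.
  by move=> [u [u1 u2 u0 [uy|uy]]]; [apply: (cut1 u y)|apply: (cut2 u y)].
apply: (@joined_ind _ _ I x y _ xy); last first.
  by have [x1 x2] := bU _ bx; exists x; split=> //; left; exact: joined_refl.
have dis' : [disjoint E2 & E1]%fset by rewrite fdisjoint_sym.
have step e v w : e \in (Q `&` (E1 `|` E2))%fset ->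
    (v = e.1 /\ w = edge_tip e) \/ (v = edge_tip e /\ w = e.1) -> I v -> I w.
  move=> eQ vw [u [u1 u2 u0 uv]].
  have ve : v = e.1 \/ v = edge_tip e by case: vw => -[]; [left|right].
  have vwJ (G : set (edge d)) : G e -> joined G v w.
    by move=> Ge; case: vw => -[-> ->]; [exact: joined_edge|exact: joined_edgeV].
  have [eE1|eE1] := boolP (e \in E1).
    have eQ1 : e \in (Q `&` E1)%fset by move: eQ; rewrite !inE eE1 => /andP[->].
    case: uv => uv.
      by exists u; split=> //; left; apply: joined_trans uv (vwJ _ _).
    have [v1 v2 v0] := cut_glue_step dis cut1 cut2 eQ1 ve u1 u2 u0 uv.
    by exists v; split=> //; left; exact: vwJ.
  have eQ2 : e \in (Q `&` E2)%fset.
    by move: eQ; rewrite !inE (negPf eE1).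
  case: uv => uv.
    have [v2 v1 v0] := cut_glue_step dis' cut2 cut1 eQ2 ve u2 u1 u0 uv.
    by exists v; split=> //; right; exact: vwJ.
  by exists u; split=> //; right; apply: joined_trans uv (vwJ _ _).
by move=> e /= eQ; split; apply: step eQ _; [left|right].
Qed.

End Cut.

Section Cost.
Variables (R : realType) (d : nat) (l : 'I_d) (p q : R).
Hypotheses (p_gt0 : 0 < p) (p_lt1 : p < 1) (q_ge1 : 1 <= q).
Implicit Types (E Q F : {fset edge d}) (e : edge d).

Definition cost E : R := - ln (fk_prob p q E (cut l E)).

(** The cost in excess of closing every crossing edge separately: [- ln (1 - p)]
    is an upper bound for the cost of closing one edge. *)
Definition excess E : R := cost E + ln (1 - p) * #|` crossing l E|%:R.

Let w_gt0 E V Q : 0 < fk_weight p q E V Q. Proof. exact: fk_weight_gt0. Qed.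

Let p'_gt0 : 0 < 1 - p. Proof. by rewrite subr_gt0. Qed.

Lemma fk_prob_gt0 E D : D fset0 -> 0 < fk_prob p q E D.
Proof. exact: fin_prob_gt0. Qed.

Lemma fk_prob_cut_gt0 E : 0 < fk_prob p q E (cut l E).
Proof. by apply: fk_prob_gt0; exact: cut0. Qed.

Lemma cost_ge0 E : 0 <= cost E.
Proof. by rewrite oppr_ge0 ln_le0 //; exact: fin_prob_le1. Qed.

(** Each factor grows when its region is enlarged to the union, and in the union
    the two cuts are positively correlated. *)
Lemma cost_glue E1 E2 : [disjoint E1 & E2]%fset ->
  cost (E1 `|` E2)%fset <= cost E1 + cost E2.
Proof.
move=> dis; rewrite -opprD lerN2.
have pos E := fk_prob_cut_gt0 E; rewrite -lnM ?posrE //.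
rewrite ler_ln ?posrE; [|by apply: mulr_gt0; exact: pos|exact: pos].
have sub (E1' E2' : {fset edge d}) : fk_prob p q E1' (cut l E1') <=
    fk_prob p q (E1' `|` E2')%fset (cut l E1').
  apply: fk_prob_mono => //; [exact: fsubsetUl|exact: cut_decreasing|].
  exact: cut_restrict.
apply: le_trans (ler_pM (ltW (pos _)) (ltW (pos _)) (sub E1 E2) (sub E2 E1)) _.
rewrite [(E2 `|` E1)%fset]fsetUC.
have dec E : decreasing (cut l E) by exact: cut_decreasing.
apply: le_trans (fk_prob_fkg p_gt0 p_lt1 q_ge1 _ (dec E1) (dec E2)) _.
by apply: fin_prob_le => // Q _ []; exact: cut_glue.
Qed.

Lemma crossing_glue E1 E2 : [disjoint E1 & E2]%fset ->
  #|` crossing l (E1 `|` E2)%fset| = (#|` crossing l E1| + #|` crossing l E2|)%N.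
Proof.
move=> /fdisjointP dis; rewrite -[RHS]cardfsUI (_ : (_ `&` _)%fset = fset0).
  rewrite cardfs0 addn0; congr #|` _|; apply/fsetP => e; rewrite !inE.
  by rewrite -andb_orl.
apply/fsetP => e; rewrite !inE; apply/negP => /andP[/andP[/dis e2 _]].
by rewrite (negPf e2).
Qed.

Lemma excess_glue E1 E2 : [disjoint E1 & E2]%fset ->
  excess (E1 `|` E2)%fset <= excess E1 + excess E2.
Proof.
move=> dis; rewrite /excess crossing_glue // natrD mulrDr addrACA lerD2r.
exact: cost_glue.
Qed.

(** Opening [e] does not increase the number of components, hence for [1 <= q]
    the random-cluster weight favours closed edges more than the density does. *)
Lemma fk_prob_closed1 e : 1 - p <= fk_prob p q [fset e]%fset [set Q | e \notin Q].
Proof.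
rewrite /fk_prob /fin_prob /fin_mean -(fsetU0 [fset e]%fset).
rewrite !sum_fpowerset_fset1U ?inE // fpowerset0 !big_seq_fset1.
rewrite indic_in ?inE // [\1__ (e |` _)%fset]indic_notin; last first.
  by rewrite /= !inE eqxx.
rewrite mulr1 mulr0 addr0 ler_pdivlMr ?addr_gt0 // fsetU0.
rewrite /fk_weight fsetD0 fsetDv cardfs0 cardfs1 !expr1 !expr0 mul1r mulr1.
set k0 := ncomponents _ _; set k1 := ncomponents _ _.
have k10 : q ^+ k1 <= q ^+ k0.
  by rewrite ler_weXn2l // kappa_mono //; exact: finite_edge_ends.
rewrite ler_pM2l // [leRHS](_ : q ^+ k0 = (1 - p) * q ^+ k0 + p * q ^+ k0).
  by rewrite lerD2l ler_pM2l.
by rewrite -mulrDl subrK mul1r.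
Qed.

Lemma fk_prob_closed E F : (F `<=` E)%fset ->
  (1 - p) ^+ #|` F| <= fk_prob p q E [set Q | [disjoint Q & F]%fset].
Proof.
have decF F' : decreasing [set Q : {fset edge d} | [disjoint Q & F']%fset].
  by move=> P Q PQ /=; exact: fdisjointWl.
elim/fset_ind_add: F => [|e F eF IH].
  move=> _; rewrite cardfs0 expr0 /fk_prob /fin_prob /fin_mean.
  have Zp : 0 < \sum_(P <- fpowerset E) fk_weight p q E (edge_ends E) P.
    by apply: sum_fpowerset_gt0 => Q.
  rewrite ler_pdivlMr // mul1r; apply: ler_sum => Q _.
  by rewrite indic_in ?mulr1 //= fdisjointX0.
rewrite fsubUset fsub1set => /andP[eE FE].
rewrite cardfsU1 eF exprS.
have dece : decreasing [set Q : {fset edge d} | e \notin Q].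
  by move=> P Q /fsubsetP PQ /=; apply: contra => /PQ.
have h : 1 - p <= fk_prob p q E [set Q | e \notin Q].
  apply: le_trans (fk_prob_closed1 e) _; apply: fk_prob_mono => //.
    by rewrite fsub1set.
  by move=> Q /=; rewrite !inE eqxx andbT.
apply: le_trans (ler_pM (ltW p'_gt0) _ h (IH FE)) _.
  by rewrite exprn_ge0 // ltW.
apply: le_trans (fk_prob_fkg p_gt0 p_lt1 q_ge1 _ dece (decF F)) _.
apply: fin_prob_le => // Q _ /= [eQ QF].
by rewrite fdisjointXU QF fdisjointX1 eQ.
Qed.

Lemma excess_fset1 e : excess [fset e]%fset <= 0.
Proof.
rewrite /excess /cost addrC subr_le0.
have [ecr|ecr] := boolP ((e.2 == l) && (e.1 l == -1)).
  have -> : crossing l [fset e]%fset = [fset e]%fset.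
    by apply/fsetP => f; rewrite !inE; case: eqP => //= ->.
  rewrite cardfs1 mulr1 ler_ln ?posrE ?fk_prob_cut_gt0 //.
  apply: le_trans (fk_prob_closed1 e) _; apply: fin_prob_le => // Q Qe eQ.
  have -> : Q = fset0; last exact: cut0.
  by move: Qe eQ; rewrite fsubset1 => /orP[/eqP ->|/eqP //]; rewrite /= inE eqxx.
(* An edge that does not cross height zero keeps to one side. *)
have -> : crossing l [fset e]%fset = fset0.
  by apply/fsetP => f; rewrite !inE; case: eqP => //= ->; exact: negbTE.
rewrite cardfs0 mulr0 ln_ge0 // -[leLHS](expr0 (1 - p)) -(cardfs0 (edge d)).
apply: le_trans (@fk_prob_closed [fset e]%fset _ (fsub0set _)) _.
apply: fin_prob_le => // Q _ _ x y _ _ x0 y0 xy.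
suff : 0 <= y l by rewrite leNgt y0.
apply: (@joined_ind _ _ (fun z => 0 <= z l) x y _ xy) => // f /=.
rewrite !inE => /andP[_ /eqP ->]; rewrite edge_tipE.
by move: ecr; rewrite eq_sym; case: eqP => /= _; lia.
Qed.

Lemma excess_le0 E : excess E <= 0.
Proof.
elim/fset_ind_add: E => [|e E eE IH].
  rewrite /excess /cost addrC subr_le0.
  have -> : crossing l fset0 = fset0 by apply/fsetP => f; rewrite !inE.
  rewrite cardfs0 mulr0 ln_ge0 // -[leLHS](expr0 (1 - p)) -(cardfs0 (edge d)).
  apply: le_trans (@fk_prob_closed fset0 _ (fsub0set _)) _.
  apply: fin_prob_le => // Q; rewrite fsubset0 => /eqP -> _; exact: cut0.
apply: le_trans (excess_glue _) _; first by rewrite fdisjoint1X.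
by rewrite -[leRHS]addr0 lerD // excess_fset1.
Qed.

(** The added region can be cut edge by edge at nonpositive excess. *)
Lemma excess_decreasing E E' : (E' `<=` E)%fset -> excess E <= excess E'.
Proof.
move=> E'E; have -> : E = (E' `|` (E `\` E'))%fset.
  apply/fsetP => e; rewrite !inE; have := fsubsetP E'E e.
  by case: (e \in E') => [-> //|] //=.
apply: le_trans (excess_glue _) _; first by apply/fdisjointP => e; rewrite !inE => ->.
by rewrite -[leRHS]addr0 lerD2l excess_le0.
Qed.

End Cost.

(** * Translation invariance *)

Section Translation.
Variables (d : nat) (v : vertex d).
Implicit Types (E Q : {fset edge d}) (e : edge d) (x y : vertex d).

Definition shift e : edge d := (e.1 + v, e.2).

Definition shift_edges E : {fset edge d} := [fset shift e | e in E]%fset.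

Lemma edge_tip_shift e : edge_tip (shift e) = edge_tip e + v.
Proof. by rewrite /edge_tip /= addrAC. Qed.

Lemma shift_inj : injective shift.
Proof. by move=> [x i] [y j] [/addIr -> ->]. Qed.

Lemma mem_shift E e : (shift e \in shift_edges E) = (e \in E).
Proof. exact: (mem_imfset _ _ shift_inj). Qed.

Lemma shift_edgesD E Q :
  shift_edges (E `\` Q)%fset = (shift_edges E `\` shift_edges Q)%fset.
Proof.
apply/fsetP => e; rewrite inE; apply/imfsetP/andP => [[f /= + ->]|[eQ /imfsetP[f /= fE ef]]].
  by rewrite !mem_shift inE => /andP.
by exists f => //=; rewrite inE fE andbT -mem_shift -ef.
Qed.

Lemma card_shift_edges E : #|` shift_edges E| = #|` E|.
Proof. by apply: card_imfset; exact: shift_inj. Qed.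

Lemma joined_shift (G G' : set (edge d)) x y :
  (forall e, G e -> G' (shift e)) -> joined G x y -> joined G' (x + v) (y + v).
Proof.
move=> GG' xy; apply: (@joined_ind _ G (fun z => joined G' (x + v) (z + v)) x y) => //.
  move=> e /GG' /[dup] Ge /joined_edge; rewrite edge_tip_shift /= => e12.
  by split=> h; apply: joined_trans h _ => //; exact: joined_sym.
exact: joined_refl.
Qed.

End Translation.

Lemma shiftK (d : nat) (v : vertex d) : cancel (shift v) (shift (- v)).
Proof. by move=> [x i]; rewrite /shift /= addrK. Qed.

Lemma shiftNK (d : nat) (v : vertex d) : cancel (shift (- v)) (shift v).
Proof. by move=> [x i]; rewrite /shift /= subrK. Qed.

Lemma shift_edgesK (d : nat) (v : vertex d) : cancel (shift_edges v) (shift_edges (- v)).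
Proof.
move=> E; apply/fsetP => e; by rewrite -{1}(shiftK v e) !mem_shift.
Qed.

Section TranslationInvariance.
Variables (R : realType) (d : nat) (l : 'I_d) (p q : R).
Implicit Types (E Q : {fset edge d}) (e : edge d) (x y v : vertex d).

Lemma mem_shiftV v E e : (e \in shift_edges v E) = (shift (- v) e \in E).
Proof. by rewrite -{1}(shiftNK v e) mem_shift. Qed.

Lemma open_outside_shift v E Q e :
  open_outside (shift_edges v E) (shift_edges v Q) (shift v e) <-> open_outside E Q e.
Proof. by rewrite /open_outside /= !mem_shift. Qed.

Lemma joined_shiftE v (G G' : set (edge d)) x y :
  (forall e, G' (shift v e) <-> G e) ->
  joined G' (x + v) (y + v) <-> joined G x y.
Proof.
move=> GG'; split; last by apply: joined_shift => e /GG'.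
move=> /(@joined_shift _ (- v) G' G); rewrite !addrK; apply=> e.
by rewrite -{1}(shiftNK v e) GG'.
Qed.

Lemma touches_shift v (G G' : set (edge d)) x :
  (forall e, G' (shift v e) <-> G e) -> touches G' (x + v) <-> touches G x.
Proof.
move=> GG'; split=> -[e Ge xe].
  exists (shift (- v) e); first by apply/GG'; rewrite shiftNK.
  rewrite edge_tip_shift /=.
  by case: xe => <-; [left|right]; rewrite addrK.
exists (shift v e); first exact/GG'.
by rewrite edge_tip_shift /=; case: xe => ->; [left|right].
Qed.

Lemma cut_shift v E Q : v l = 0 ->
  cut l (shift_edges v E) (shift_edges v Q) <-> cut l E Q.
Proof.
move=> v0; have vl x : (x + v) l = x l by rewrite ffunE v0 addr0.
have bE x : boundary (shift_edges v E) (x + v) <-> boundary E x.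
  by apply: touches_shift => e /=; rewrite mem_shift.
have jE x y : joined [set` (shift_edges v Q `&` shift_edges v E)%fset] (x + v) (y + v)
    <-> joined [set` (Q `&` E)%fset] x y.
  by apply: joined_shiftE => e /=; rewrite !inE !mem_shift.
split=> [h x y bx by_ x0 y0 xy|h x y].
  by apply: (h (x + v) (y + v)); rewrite ?vl //; [exact/bE|exact/bE|exact/jE].
rewrite -(subrK v x) -(subrK v y) !vl => /bE bx /bE by_ x0 y0 /jE; exact: h.
Qed.

Lemma fk_weight_shift v E Q : (Q `<=` E)%fset ->
  fk_weight p q (shift_edges v E) (edge_ends (shift_edges v E)) (shift_edges v Q) =
  fk_weight p q E (edge_ends E) Q.
Proof.
move=> QE; rewrite /fk_weight -shift_edgesD !card_shift_edges; congr (_ * _ ^+ _).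
rewrite !ncomponentsE; try exact: finite_edge_ends.
have vE : fset_set (edge_ends (shift_edges v E)) =
    ((fun x : vertex d => (x + v)%R) @` fset_set (edge_ends E))%fset.
  rewrite -fset_set_image; last exact: finite_edge_ends.
  congr fset_set; apply/seteqP; split=> x /=.
    rewrite -{1}(subrK v x) => xE; exists (x - v); last by rewrite subrK.
    by move: xE; apply: (proj1 (touches_shift _ _)) => e /=; rewrite mem_shift.
  by move=> [y yE <-]; move: yE; apply: (proj2 (touches_shift _ _)) => e /=; rewrite mem_shift.
rewrite vE -imfset_comp; apply: card_imfset_kernel => x y _ _ /=.
by rewrite !eq_component; apply: joined_shiftE; exact: open_outside_shift.
Qed.

Lemma fk_prob_cut_shift v E : v l = 0 ->
  fk_prob p q (shift_edges v E) (cut l (shift_edges v E)) = fk_prob p q E (cut l E).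
Proof.
move=> v0; apply: (@fin_prob_bij _ _ _ _ _ (shift_edges v) (shift_edges (- v)) _ _ 1).
- move=> P /fsubsetP PE; apply/fsubsetP => e; rewrite !mem_shiftV; exact: PE.
- move=> P /fsubsetP PE; apply/fsubsetP => e; rewrite mem_shiftV opprK => /PE.
  by rewrite mem_shift.
- by move=> P _; exact: shift_edgesK.
- by move=> P _; rewrite -{1}(opprK v) shift_edgesK.
- exact: oner_neq0.
- by move=> P PE; rewrite mul1r fk_weight_shift.
- by move=> P PE; exact: cut_shift.
Qed.

Lemma excess_shift v E : v l = 0 ->
  excess l p q (shift_edges v E) = excess l p q E.
Proof.
move=> v0; rewrite /excess /cost fk_prob_cut_shift //; congr (_ + _ * _%:R).
rewrite -[RHS](card_shift_edges v); congr #|` _|; apply/fsetP => e.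
rewrite -(shiftNK v e) mem_shift !inE mem_shift /=.
by rewrite ffunE v0 addr0.
Qed.

End TranslationInvariance.

(** * Boxes and tilings *)

(** By [dual_boxP], the edges of the box [[-N, N - 1]^d] of the dual lattice. *)
Definition dual_box (d N : nat) : {fset edge d} :=
  [fset dual_edge c | c in interior_plaquettes d N]%fset.

Lemma in_interior_plaquettes (d N : nat) (c : plaquette d) :
  (c \in interior_plaquettes d N) = interior_cell N (plaquette_cell c).
Proof.
rewrite in_fset_set; last exact: finite_interior_plaquettes.
by apply/idP/idP; rewrite in_setE.
Qed.

Lemma in_interior_edges (d N : nat) (e : edge d) :
  (e \in interior_edges d N) = interior_cell N (edge_cell e).
Proof.
rewrite in_fset_set; last exact: finite_interior_edges.
by apply/idP/idP; rewrite in_setE.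
Qed.

Lemma dual_edge_inj (d : nat) : injective (@dual_edge d).
Proof. by move=> [x i] [y j] [/[swap] <- /addIr ->]. Qed.

Definition dual_plaquette (d : nat) (e : edge d) : plaquette d := (edge_tip e, e.2).

Lemma dual_edgeK (d : nat) : cancel (@dual_edge d) (@dual_plaquette d).
Proof. by move=> [x i]; rewrite /dual_plaquette /edge_tip /= subrK. Qed.

Lemma dual_plaquetteK (d : nat) : cancel (@dual_plaquette d) (@dual_edge d).
Proof. by move=> [x i]; rewrite /dual_edge /edge_tip /= addrK. Qed.

Lemma dual_edge_in_box (d N : nat) (c : plaquette d) :
  (dual_edge c \in dual_box d N) = interior_cell N (plaquette_cell c).
Proof. by rewrite (mem_imfset _ _ (@dual_edge_inj d)) /= in_interior_plaquettes. Qed.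

Lemma interior_plaquetteP (d N : nat) (c : plaquette d) :
  reflect (forall j, - N%:Z + (j == c.2)%:Z <= c.1 j < N%:Z)
    (interior_cell N (plaquette_cell c)).
Proof.
case: c => x i; rewrite /interior_cell /in_bdbox; case: (boolP (in_box _ _)) => /=.
  move=> /forallP /= xN; apply: (iffP idP) => [|xi].
    rewrite negb_exists => /forallP xi j; have := xN j; have := xi j.
    by rewrite !inE negbK; case: (j == i) => /=; lia.
  apply/existsPn => j; rewrite !inE negbK; have := xi j; have := xN j.
  by rewrite !inE; case: (j == i) => /=; lia.
move=> xN; apply: ReflectF => xi; case/forallPn: xN => /= j; move: (xi j).
by rewrite !inE; case: (j == i) => /=; lia.
Qed.

Lemma dual_boxP (d N : nat) (e : edge d) :
  reflect (forall j, - N%:Z <= e.1 j /\ edge_tip e j < N%:Z) (e \in dual_box d N).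
Proof.
rewrite -(dual_plaquetteK e) dual_edge_in_box dual_plaquetteK.
apply: (iffP (interior_plaquetteP _ _)) => /= eN j; have := eN j; rewrite edge_tipE;
  case: (j == e.2) => /=; lia.
Qed.

Lemma interior_edgeP (d N : nat) (e : edge d) :
  reflect (forall j, [/\ - N%:Z <= e.1 j, edge_tip e j <= N%:Z &
                         j != e.2 -> - N%:Z < e.1 j < N%:Z])
    (e \in interior_edges d N).
Proof.
rewrite in_interior_edges; case: e => x i.
rewrite /interior_cell /in_bdbox; case: (boolP (in_box _ _)) => /=.
  move=> /forallP /= xN; apply: (iffP idP) => [|xi].
    rewrite negb_exists => /forallP xi j; have := xN j; have := xi j.
    by rewrite edge_tipE !inE /=; case: (j == i) => /=; split=> //; lia.
  apply/existsPn => j; rewrite !inE; have := xi j; rewrite edge_tipE /=.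
  by case: (j == i) => //= -[_ _ /(_ isT)]; lia.
move=> xN; apply: ReflectF => xi; case/forallPn: xN => /= j; move: (xi j).
by rewrite edge_tipE !inE /=; case: (j == i) => /= -[x1 x2 _]; lia.
Qed.

Lemma dual_box_sub_interior_edges (d N : nat) :
  (dual_box d N `<=` interior_edges d N.+1)%fset.
Proof.
apply/fsubsetP => e /dual_boxP eN; apply/interior_edgeP => j; have := eN j.
by rewrite edge_tipE; case: (j == e.2) => /=; split=> //; lia.
Qed.

Lemma interior_edges_sub_dual_box (d N : nat) :
  (interior_edges d N `<=` dual_box d N.+1)%fset.
Proof.
apply/fsubsetP => e /interior_edgeP eN; apply/dual_boxP => j; have := eN j.
by rewrite edge_tipE; case: (j == e.2) => /= -[x1 x2 x3]; [|have := x3 isT]; lia.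
Qed.

Lemma int_range (z : int) (N : nat) : - N%:Z <= z /\ z + 0 < N%:Z ->
  exists2 t, (t < 2 * N)%N & z = - N%:Z + 1 * t%:Z.
Proof.
move=> [z1 z2]; have : 0 <= z + N%:Z by lia.
by case E : (z + N%:Z) => [t|//] _; exists t; lia.
Qed.

Lemma vertexD (d : nat) (x y : vertex d) j : (x + y) j = x j + y j.
Proof. by rewrite ffunE. Qed.

Lemma vertexN (d : nat) (x : vertex d) j : (- x) j = - x j.
Proof. by rewrite ffunE. Qed.

Section Grid.
Variables (d : nat) (l : 'I_d).

(** Functions on the coordinates other than [l] parametrize the grid, which makes
    it easy to count. *)
Definition grid_point (n : nat) (s a c : int)
    (f : {ffun {j : 'I_d | j != l} -> 'I_n}) : vertex d :=
  [ffun j => if insub j is Some u then a + s * (f u : nat)%:Z else c].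

Definition grid (n : nat) (s a c : int) : {fset vertex d} :=
  [fset grid_point s a c f | f : {ffun {j : 'I_d | j != l} -> 'I_n}]%fset.

Lemma gridP n s a c (x : vertex d) :
  reflect (x l = c /\ forall j, j != l -> exists2 t, (t < n)%N & x j = a + s * t%:Z)
    (x \in grid n s a c).
Proof.
apply: (iffP (imfsetP _ _ _ _)) => [[f _ ->]|[xl xj]].
  split=> [|j jl]; rewrite ffunE; first by rewrite insubF ?eqxx.
  by rewrite (insubT (fun j => j != l) jl); exists (f (Sub j jl)).
have xt (u : {j : 'I_d | j != l}) : exists t : 'I_n, x (val u) == a + s * (t : nat)%:Z.
  by have [t tn ->] := xj _ (valP u); exists (Ordinal tn).
exists [ffun u => xchoose (xt u)] => //; apply/ffunP => j; rewrite ffunE.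
case: insubP => [u _ <-|]; first by rewrite ffunE; apply/eqP; exact: (xchooseP (xt u)).
by rewrite negbK => /eqP ->.
Qed.

Lemma card_grid n s a c : s != 0 -> #|` grid n s a c| = (n ^ d.-1)%N.
Proof.
move=> s0; rewrite card_imfset /=.
  rewrite -cardE card_ffun card_ord card_sig; congr (_ ^ _)%N.
  by have := cardC1 l; rewrite card_ord => <-.
move=> f g fg; apply/ffunP => u; apply/val_inj.
have := congr1 (fun h : vertex d => h (val u)) fg; rewrite !ffunE valK.
by move=> /addrI /(mulfI s0) [].
Qed.

Lemma card_crossing_dual_box N : #|` crossing l (dual_box d N.+1)| = ((2 * N.+1) ^ d.-1)%N.
Proof.
rewrite -(@card_grid _ 1 (- N.+1%:Z) (-1)) //.
have inj : injective (fun x : vertex d => (x, l)) by move=> x y [].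
pose G := grid (2 * N.+1) 1 (- N.+1%:Z) (-1).
have <- : #|` [fset ((x, l) : edge d) | x in G]%fset| = #|` G| by exact: card_imfset.
congr #|` _|; apply/fsetP => e.
apply/idP/imfsetP => [|[x /= /gridP[xl xj] ->]].
  rewrite !inE /= => /andP[/dual_boxP eN /andP[/eqP el /eqP xl]].
  exists e.1; last by rewrite -el; case: (e).
  apply/gridP; split=> // j jl; have := eN j; rewrite edge_tipE el (negPf jl).
  exact: int_range.
rewrite !inE /= xl !eqxx !andbT; apply/dual_boxP => j; rewrite edge_tipE /=.
by case: (eqVneq j l) => [->|/xj[t tn ->]]; rewrite ?xl /=; lia.
Qed.

End Grid.

Section Tiling.
Variables (R : realType) (d : nat) (l : 'I_d) (p q : R).
Hypotheses (p_gt0 : 0 < p) (p_lt1 : p < 1) (q_ge1 : 1 <= q).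

Lemma excess_shifts (E : {fset edge d}) (O : {fset vertex d}) :
  (forall v, v \in O -> v l = 0) ->
  (forall (v w : vertex d) (e : edge d), v \in O -> w \in O -> e \in shift_edges v E ->
     e \in shift_edges w E -> v = w) ->
  exists2 U : {fset edge d},
    excess l p q U <= #|` O|%:R * excess l p q E &
    forall e, e \in U -> exists2 v, v \in O & e \in shift_edges v E.
Proof.
elim/fset_ind_add: O => [_ _|v O vO IH O0 dis].
  by exists fset0; rewrite ?cardfs0 ?mul0r ?excess_le0.
have [w wO|w w' e wO w'O|U UO UP] := IH.
- by apply: O0; rewrite fset1Ur.
- by apply: dis; rewrite fset1Ur.
exists (shift_edges v E `|` U)%fset.
  apply: le_trans (excess_glue _ _ _ _ _) _ => //.
    apply/fdisjointP => e ev; apply/negP => /UP[w wO ew].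
    by move: vO; rewrite (dis v w e) ?wO ?fset1U1 ?fset1Ur.
  rewrite excess_shift ?O0 ?fset1U1 // cardfsU1 vO natrD mulrDl mul1r.
  by rewrite lerD2l.
move=> e; rewrite inE => /orP[ev|/UP[w wO ew]].
  by exists v => //; rewrite fset1U1.
by exists w => //; rewrite fset1Ur.
Qed.

Lemma excess_tiling (N k M : nat) : (0 < N)%N -> (0 < k)%N -> (k * N <= M)%N ->
  excess l p q (dual_box d M) <= k%:R ^+ d.-1 * excess l p q (dual_box d N).
Proof.
move=> N0 k0 kNM.
have N20 : 2 * N%:Z != 0 by lia.
pose O := grid l k (2 * N%:Z) (N%:Z - M%:Z) 0.
have tileP (v : vertex d) (e : edge d) : e \in shift_edges v (dual_box d N) ->
    forall j, v j - N%:Z <= e.1 j /\ edge_tip e j < v j + N%:Z.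
  rewrite mem_shiftV => /dual_boxP eN j; have := eN j.
  by rewrite !edge_tipE /= vertexD vertexN; case: (j == e.2) => /=; lia.
have [||U UO UP] := @excess_shifts (dual_box d N) O.
- by move=> v /gridP[].
- move=> v w e /gridP[vl vj] /gridP[wl wj] /tileP ev /tileP ew.
  apply/ffunP => j; have [->|jl] := eqVneq j l; first by rewrite vl wl.
  have [t tk vt] := vj _ jl; have [u uk wu] := wj _ jl.
  suff tu : t = u by rewrite vt wu tu.
  have := ev j; have := ew j; rewrite edge_tipE vt wu.
  have [//|tu|tu] := ltngtP t u; nia.
rewrite -natrX -(@card_grid _ l k (2 * N%:Z) (N%:Z - M%:Z) 0) //.
apply: le_trans UO; apply: excess_decreasing => //.
apply/fsubsetP => e /UP[v /gridP[vl vj] /tileP ev]; apply/dual_boxP => j.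
have := ev j; have [->|jl] := eqVneq j l; first by rewrite vl; nia.
by have [t tk ->] := vj _ jl; nia.
Qed.

End Tiling.

(** * Limits per unit of area *)

Section Limits.
Variable R : realType.
Implicit Types (x s : nat -> R) (c : R) (D n N M : nat).

Lemma bernoulli_ineq (t : R) D : 0 <= t <= 1 -> 1 - D%:R * t <= (1 - t) ^+ D.
Proof.
move=> /andP[t0 t1]; elim: D => [|D IH]; first by rewrite mul0r subr0 expr0.
rewrite exprS; apply: le_trans (ler_wpM2l _ IH); last by rewrite subr_ge0.
have Dt : 0 <= D%:R * t * t by rewrite !mulr_ge0.
rewrite -natr1 mulrDl mul1r mulrBl mul1r mulrBr mulr1; move: Dt.
by rewrite -mulrA (mulrCA t); lra.
Qed.

(** A sequence that is subadditive for tilings of cubes of side [2 M] by cubes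
    of side [2 N] has a limit per unit of area.  Being nonpositive, it does not
    notice the part of the large cube that the tiles leave uncovered. *)
Lemma cvg_tiling x D c : (forall M, x M <= 0) ->
  (forall M, (0 < M)%N -> - (c * (2 * M%:R) ^+ D) <= x M) ->
  (forall N k M, (0 < N)%N -> (0 < k)%N -> (k * N <= M)%N ->
     x M <= k%:R ^+ D * x N) ->
  exists L : R, x N / (2 * N%:R) ^+ D @[N --> \oo] --> L.
Proof.
move=> x_le0 x_ge xsub; pose u N := x N / (2 * N%:R) ^+ D.
have pow_gt0 N : (0 < N)%N -> 0 < (2 * N%:R) ^+ D :> R.
  by move=> N0; rewrite exprn_gt0 // mulr_gt0 // ltr0n.
have u_le0 N : u N <= 0.
  by rewrite /u mulr_le0_ge0 // invr_ge0 exprn_ge0 // mulr_ge0.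
have u_ge N : (0 < N)%N -> - c <= u N.
  by move=> N0; rewrite /u ler_pdivlMr ?pow_gt0 // mulNr x_ge.
have u_tile N M : (0 < N)%N -> (N <= M)%N -> u M <= u N + D%:R * N%:R * c / M%:R.
  move=> N0 NM; have M0 : (0 < M)%N by apply: leq_trans NM.
  pose k := (M %/ N)%N; have k0 : (0 < k)%N by rewrite divn_gt0.
  have Mr : 0 < M%:R :> R by rewrite ltr0n.
  have M0' : M%:R != 0 :> R by rewrite gt_eqF.
  pose t : R := N%:R / M%:R; have t01 : 0 <= t <= 1.
    by rewrite divr_ge0 //= ler_pdivrMr // mul1r ler_nat.
  (* Along each direction [k] tiles cover the fraction [k N / M]. *)
  have uM : u M <= (k%:R * N%:R / M%:R) ^+ D * u N.
    rewrite {1}/u ler_pdivrMr ?pow_gt0 //.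
    apply: le_trans (xsub N k M N0 k0 (leq_divM _ _)) _.
    have -> : x N = u N * (2 * N%:R) ^+ D by rewrite /u divfK // gt_eqF ?pow_gt0.
    have -> : (k%:R * N%:R / M%:R) ^+ D * u N * (2 * M%:R) ^+ D =
        (k%:R * N%:R / M%:R * M%:R * 2) ^+ D * u N.
      by rewrite mulrAC -exprMn; congr (_ ^+ _ * _); rewrite (mulrC 2) [LHS]mulrA.
    rewrite (divfK M0') (_ : k%:R * N%:R * 2 = k%:R * (2 * N%:R)).
      by rewrite [in leRHS]exprMn mulrCA [leRHS]mulrC.
    by rewrite -mulrA (mulrC 2).
  apply: le_trans uM _.
  have kNM : (1 - t) <= k%:R * N%:R / M%:R.
    rewrite ler_pdivlMr // mulrBl mul1r (divfK M0') lerBlDr -natrM -natrD ler_nat.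
    by rewrite {1}(divn_eq M N) leq_add2l ltnW // ltn_mod.
  have /andP[t0 t1] := t01.
  have pow : 1 - D%:R * t <= (k%:R * N%:R / M%:R) ^+ D.
    apply: le_trans (bernoulli_ineq D t01) _; apply: lerXn2r => //.
      by rewrite nnegrE subr_ge0.
    by rewrite nnegrE divr_ge0 // mulr_ge0.
  apply: le_trans (ler_wnM2r (u_le0 N) pow) _.
  rewrite mulrBl mul1r lerD2l -mulrN (_ : D%:R * N%:R * c / M%:R = D%:R * t * c).
    by rewrite ler_wpM2l ?mulr_ge0 // lerNl u_ge.
  by rewrite /t mulrAC [in RHS]mulrA.
pose S := [set u N | N in [set N | (0 < N)%N]].
have Su N : (0 < N)%N -> S (u N) by exists N.
have lS : has_lbound S by exists (- c) => _ [N N0 <-]; exact: u_ge.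
have infS : has_inf S by split=> //; exists (u 1%N); exact: Su.
have c_ge0 : 0 <= c by have := u_ge 1%N isT; have := u_le0 1%N; lra.
exists (inf S); apply/cvgrPdist_le => e e0.
have [_ [N N0 <-] uN] := inf_adherent (divr_gt0 e0 (ltr0Sn R 1)) infS.
near=> M; have NM : (N <= M)%N by near: M; exact: nbhs_infty_ge.
have M0 : (0 < M)%N by apply: leq_trans NM.
have : inf S <= u M by apply: ge_inf => //; exact: Su.
rewrite distrC -/(u M) ler_norml => iM; apply/andP; split; first lra.
rewrite lerBlDr; apply: le_trans (u_tile N M N0 NM) _.
suff : D%:R * N%:R * c / M%:R <= e / 2 by lra.
rewrite ler_pdivrMr ?ltr0n // -ler_pdivrMl ?divr_gt0 //.
near: M; exact: nbhs_infty_ger.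
Unshelve. all: by end_near. Qed.

Lemma pow_ratio_cvg D (f : nat -> R) :
  f n / n.+1%:R @[n --> \oo] --> (1 : R) ->
  (2 * f n) ^+ D / (2 * n.+1%:R) ^+ D @[n --> \oo] --> (1 : R).
Proof.
move=> f1; have -> : (fun n => (2 * f n) ^+ D / (2 * n.+1%:R) ^+ D) =
    (fun n => (f n / n.+1%:R) ^+ D).
  apply/funext => n; rewrite -expr_div_n; congr (_ ^+ _).
  by rewrite -mulf_div divff ?mul1r.
rewrite -[X in _ --> X](expr1n _ D).
exact: (continuous_cvg _ (@exprn_continuous R D 1) f1).
Qed.

Lemma pow_ratio_pred D :
  (2 * n%:R) ^+ D / (2 * n.+1%:R) ^+ D @[n --> \oo] --> (1 : R).
Proof.
apply: (@pow_ratio_cvg D (fun n => n%:R)).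
have -> : (fun n => n%:R / n.+1%:R) = (fun n => 1 - harmonic n) :> (nat -> R).
  by apply/funext => n; rewrite /harmonic /= -[in LHS](addrK 1 n%:R) natr1 mulrBl divff ?mul1r.
rewrite -[X in _ --> X]subr0; apply: cvgB; [exact: cvg_cst|exact: cvg_harmonic].
Qed.

Lemma pow_ratio_succ D :
  (2 * n.+2%:R) ^+ D / (2 * n.+1%:R) ^+ D @[n --> \oo] --> (1 : R).
Proof.
apply: (@pow_ratio_cvg D (fun n => n.+2%:R)).
have -> : (fun n => n.+2%:R / n.+1%:R) = (fun n => 1 + harmonic n) :> (nat -> R).
  by apply/funext => n; rewrite /harmonic /= -[in LHS]natr1 mulrDl divff ?mul1r.
rewrite -[X in _ --> X]addr0; apply: cvgD; [exact: cvg_cst|exact: cvg_harmonic].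
Qed.

(** [s] is the cost of the wired cubes: the lower bound loses [k] for each unit of
    a boundary strip, whose area is negligible. *)
Lemma cvg_cost_between x s (D : nat) (c k L : R) :
  x N / (2 * N%:R) ^+ D @[N --> \oo] --> L ->
  (forall n, x n.+2 + c * (2 * n%:R) ^+ D -
      k * ((2 * n.+1%:R) ^+ D - (2 * n%:R) ^+ D) <= s n.+1) ->
  (forall n, s n.+1 <= x n + c * (2 * n.+2%:R) ^+ D) ->
  s N / (2 * N%:R) ^+ D @[N --> \oo] --> L + c.
Proof.
move=> xL s_ge s_le; rewrite -cvg_shiftS /=.
pose v n : R := (2 * n%:R) ^+ D.
have v0 n : v n.+1 != 0 by rewrite expf_neq0 // mulf_neq0.
have v_gt0 n : 0 < v n.+1 by rewrite exprn_gt0 // mulr_gt0.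
have a1 := pow_ratio_pred D; have b1 := pow_ratio_succ D.
have xL2 : x n.+2 / v n.+2 @[n --> \oo] --> L.
  by rewrite (cvg_shiftS (fun n => x n.+1 / v n.+1)) (cvg_shiftS (fun n => x n / v n)).
apply: (@squeeze_cvgr _ _ _ _
  (fun n => x n.+2 / v n.+2 * (v n.+2 / v n.+1) + c * (v n / v n.+1) -
            k * (1 - v n / v n.+1))
  (fun n => x n / v n * (v n / v n.+1) + c * (v n.+2 / v n.+1))).
- near=> n; have vn : v n != 0.
    by rewrite -(ltn_predK (m := 0%N) (n := n)) //; near: n; exact: nbhs_infty_gt.
  have -> : x n.+2 / v n.+2 * (v n.+2 / v n.+1) + c * (v n / v n.+1) -
      k * (1 - v n / v n.+1) =
      (x n.+2 + c * v n - k * (v n.+1 - v n)) / v n.+1.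
    by rewrite mulrA (divfK (v0 n.+1)) [RHS]mulrBl mulrDl -!mulrA mulrBl divff.
  have -> : x n / v n * (v n / v n.+1) + c * (v n.+2 / v n.+1) =
      (x n + c * v n.+2) / v n.+1.
    by rewrite mulrA (divfK vn) mulrDl mulrA.
  by rewrite -/(v n.+1) !ler_pM2r ?invr_gt0 // s_ge s_le.
- rewrite [X in _ --> X](_ : _ = L * 1 + c * 1 - k * (1 - 1)); last first.
    by rewrite subrr mulr0 subr0 !mulr1.
  apply: cvgB; first apply: cvgD.
  + exact: cvgM.
  + by apply: cvgM => //; exact: cvg_cst.
  + by apply: cvgM; [exact: cvg_cst|apply: cvgB => //; exact: cvg_cst].
- rewrite [X in _ --> X](_ : _ = L * 1 + c * 1); last by rewrite !mulr1.
  by apply: cvgD; [exact: cvgM|apply: cvgM => //; exact: cvg_cst].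
Unshelve. all: by end_near. Qed.

End Limits.

(** * Chains as forms on the dual lattice *)

Section Chains.
Variables (A : nzRingType) (d : nat).
Implicit Types (f g : chain A d) (x y : vertex d) (i j : 'I_d).

(** The sign relating the orientation of a plaquette with normal direction [i]
    to the orientation of the dual edge that crosses it. *)
Definition dual_sign i : A := (-1) ^+ #|[set k in ~: [set i] | (k < i)%N]%SET|.

(** A chain of plaquettes read as a 1-form on the dual lattice. *)
Definition dual_form f (c : plaquette d) : A := dual_sign c.2 * f (plaquette_cell c).

Lemma dual_signK i (a : A) : dual_sign i * (dual_sign i * a) = a.
Proof. by rewrite mulrA -expr2 sqrr_sign mul1r. Qed.

Lemma dual_signC i j (a : A) :
  dual_sign i * (dual_sign j * a) = dual_sign j * (dual_sign i * a).
Proof. by rewrite !mulrA /dual_sign -!exprD addnC. Qed.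

Lemma chain_boundaryB f g c :
  chain_boundary (fun c => f c - g c) c = chain_boundary f c - chain_boundary g c.
Proof.
rewrite /chain_boundary -sumrB; apply: eq_bigr => i _; rewrite -mulrBr; congr (_ * _).
by rewrite !opprB addrACA [RHS]addrACA; congr (_ + _); exact: addrC.
Qed.

Lemma chain_boundary_dual_sign i f c :
  chain_boundary (fun c => dual_sign i * f c) c = dual_sign i * chain_boundary f c.
Proof.
rewrite /chain_boundary mulr_sumr; apply: eq_bigr => k _; rewrite -mulrBr !mulrA.
by congr (_ * _); rewrite /dual_sign -!exprD addnC.
Qed.

(** The boundary of a chain at a (d-2)-cell is, up to sign, the circulation of its
    dual form around the dual square that the cell pierces. *)
Lemma chain_boundary_curl f x i j : i != j ->
  chain_boundary f (x, ~: [set i; j])%SET =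
  (-1) ^+ (j < i)%N * (dual_sign i * (dual_sign j *
    ((dual_form f (x - unit_vector i, j) - dual_form f (x, j)) -
     (dual_form f (x - unit_vector j, i) - dual_form f (x, i))))).
Proof.
move=> ij; rewrite /chain_boundary /=.
have comp (a b : 'I_d) : a != b -> (a |: ~: [set a; b])%SET = (~: [set b])%SET.
  move=> ab; apply/setP => k; rewrite !inE; case: (eqVneq k a) => [->|] //=.
have sgn (a b : 'I_d) : a != b ->
    (-1) ^+ #|[set k in ~: [set a; b] | (k < a)%N]%SET| = (-1) ^+ (b < a)%N * dual_sign a.
  move=> ab; pose T := [set k in ~: [set a; b] | (k < a)%N]%SET.
  rewrite /dual_sign [in RHS](_ : #|_| = (b < a)%N + #|T|)%N.
    by rewrite exprD mulrA -expr2 sqrr_sign mul1r.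
  rewrite (cardsD1 b [set k in _ | _]%SET).
  rewrite !inE eq_sym ab /=; congr (_ + #|pred_of_set _|)%N.
  by apply/setP => k; rewrite !inE negb_or; case: (k == b); rewrite ?andbF ?andbT.
rewrite (bigD1 i) ?inE ?negb_or ?negbK ?eqxx //=.
rewrite (bigD1 j) ?inE ?negbK ?eqxx ?orbT ?andbT 1?eq_sym //= big1 ?addr0; last first.
  by move=> k; rewrite !inE negbK => /andP[/andP[/orP[/eqP ->|/eqP ->]]]; rewrite eqxx.
have ji : j != i by rewrite eq_sym.
have sgnj : (-1) ^+ #|[set k in ~: [set i; j] | (k < j)%N]%SET| = (-1) ^+ (i < j)%N * dual_sign j.
  by rewrite (finset.setUC [set i]%SET); exact: sgn.
have compj : (j |: ~: [set i; j])%SET = (~: [set i])%SET.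
  by rewrite (finset.setUC [set i]%SET); exact: comp.
rewrite comp // compj sgn // sgnj /dual_form /plaquette_cell /= -!mulrBr.
move: (f (x - unit_vector i, _) - _) (f (x - unit_vector j, _) - _) => F G.
rewrite [dual_sign j * (_ - _)]mulrBr dual_signK [dual_sign i * (_ - _)]mulrBr.
rewrite (dual_signC i j) dual_signK mulrBr -!mulrA; congr (_ + _).
rewrite -mulNr; congr (_ * _).
by have [ij'|ji'|ij'] := ltngtP i j; rewrite ?opprK //; case/eqP: ij; exact: val_inj.
Qed.

Lemma chain_boundary_curl_eq0 f x i j : i != j ->
  (chain_boundary f (x, ~: [set i; j])%SET = 0 <->
   dual_form f (x - unit_vector i, j) - dual_form f (x, j) =
   dual_form f (x - unit_vector j, i) - dual_form f (x, i)).
Proof.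
move=> ij; rewrite chain_boundary_curl //; split=> [/eqP|->].
  by rewrite !(mulrI_eq0 _ (@lreg_sign _ _)) subr_eq0 => /eqP.
by rewrite subrr !mulr0.
Qed.

Definition top_chain (W : vertex d -> A) : chain A d :=
  fun c => if c.2 == [set: 'I_d]%SET then W c.1 else 0.

Lemma chain_boundary_top W x i :
  chain_boundary (top_chain W) (x, ~: [set i])%SET =
  dual_sign i * (W (x - unit_vector i) - W x).
Proof.
rewrite /chain_boundary /= (bigD1 i) /=; last by rewrite !inE eqxx.
rewrite big1 ?addr0; last first.
  by move=> k; rewrite !inE negbK => /andP[/eqP ->]; rewrite eqxx.
by rewrite /top_chain /= finset.setUCr eqxx.
Qed.

Lemma chain_boundary_top0 W c :
  (forall i, c.2 != ~: [set i])%SET -> chain_boundary (top_chain W) c = 0.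
Proof.
move=> ci; apply: big1 => i ic; rewrite /top_chain /=.
suff -> : (i |: c.2 == [set: 'I_d])%SET = false by rewrite subrr mulr0.
apply: contraNF (ci i) => /eqP iT; apply/eqP/setP => k; rewrite !inE.
have := finset.in_setT k; rewrite -iT !inE; case: eqVneq => [->|] //= _.
by rewrite (negPf ic).
Qed.

(** The dual form of the boundary of a top-dimensional chain is a gradient, hence
    has no circulation. *)
Lemma chain_boundary2_top W c : chain_boundary (chain_boundary (top_chain W)) c = 0.
Proof.
have [|nij] := boolP [exists i, exists j, (i != j) && (c.2 == ~: [set i; j])%SET].
  move=> /existsP[i /existsP[j /andP[ij /eqP cij]]].
  case: c cij => x S /= ->; apply/chain_boundary_curl_eq0 => //.
  rewrite /dual_form /plaquette_cell /= !chain_boundary_top !dual_signK.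
  rewrite !opprB addrACA [RHS]addrACA; congr (_ + _); last exact: addrC.
  by rewrite addrAC.
apply: big1 => i ic; rewrite !chain_boundary_top0 ?subrr ?mulr0 // => j /=;
  apply: contra nij => /eqP icj; apply/existsP; exists i; apply/existsP; exists j;
  have ij : i != j by [have := setU11 i c.2; rewrite icj !inE];
  rewrite ij /=; apply/eqP/setP => k; have := congr1 (fun S : {set 'I_d} => k \in S) icj;
  rewrite !inE negb_or; case: eqVneq => [->|//] /=; by rewrite (negbTE ic).
Qed.

End Chains.

(** * Duality between fillings of the loop and cuts *)

Section Potential.
Variables (A : nzRingType) (d : nat) (l : 'I_d) (N : nat).
Variable w : plaquette d -> A.
Hypothesis w_out : forall c, ~~ interior_cell N (plaquette_cell c) -> w c = 0.
Hypothesis w_closed : forall x (i j : 'I_d), i != j ->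
  w (x - unit_vector i, j) - w (x, j) = w (x - unit_vector j, i) - w (x, i).
Implicit Types (x v : vertex d) (K : nat).

Lemma vertex_mulrn (j : 'I_d) k v : (unit_vector j *+ k + v) j = k%:Z + v j.
Proof.
by elim: k => [|k IH]; rewrite ?mulr0n ?add0r // mulrS -addrA vertexD IH ffunE eqxx; lia.
Qed.

Lemma vertex_mulrn_other (i j : 'I_d) k v : i != j ->
  (unit_vector j *+ k + v) i = v i.
Proof.
move=> ij; elim: k => [|k IH]; rewrite ?mulr0n ?add0r //.
by rewrite mulrS -addrA vertexD IH ffunE (negPf ij) add0r.
Qed.

Definition outside v := exists j, (v j < - N%:Z) \/ (N%:Z <= v j).

(** The form is integrated from infinity along the direction [l].  It vanishes
    outside of the box, so [K] is immaterial once the ray has left the box. *)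
Definition potential K x : A := \sum_(k < K) w (unit_vector l *+ k.+1 + x, l).

(** As [w] is closed, the sum of the increments of [w (_, l)] along the ray
    telescopes. *)
Lemma potential_step K x (i : 'I_d) : potential K (x - unit_vector i) =
  potential K x + w (x, i) - w (unit_vector l *+ K + x, i).
Proof.
elim: K => [|K IH]; first by rewrite /potential !big_ord0 mulr0n !add0r subrr.
rewrite /potential !big_ord_recr /= -!/(potential K _) IH.
set y := unit_vector l *+ K.+1 + x.
have -> : unit_vector l *+ K.+1 + (x - unit_vector i) = y - unit_vector i by rewrite addrA.
have -> : unit_vector l *+ K + x = y - unit_vector l.
  by rewrite /y mulrSr [in RHS](addrAC _ _ x) addrK.
have yE : w (y - unit_vector i, l) - w (y - unit_vector l, i) = w (y, l) - w (y, i).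
  have [->|il] := eqVneq i l; first by rewrite !subrr.
  rewrite -[w (y - unit_vector i, l)](subrK (w (y, l))) (w_closed y il).
  by rewrite addrAC [X in X + _]addrAC subrr add0r addrC.
by rewrite -[LHS]addrA [- _ + _]addrC yE addrA [in LHS](addrAC _ (w (x, i))).
Qed.

Lemma w_edge_out e : e \notin dual_box d N -> w (dual_plaquette e) = 0.
Proof. by rewrite -{1}(dual_plaquetteK e) dual_edge_in_box; exact: w_out. Qed.

Lemma w_outside x i : outside x -> w (x, i) = 0.
Proof.
move=> [j xj]; apply: w_out; apply/negP => /interior_plaquetteP/(_ j) /=.
by case: (j == i) => /=; lia.
Qed.

Lemma potential_edge K e : N%:Z <= edge_tip e l + K%:Z ->
  potential K e.1 = potential K (edge_tip e) + w (dual_plaquette e).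
Proof.
move=> eK; have := potential_step K (edge_tip e) e.2.
rewrite {1}/edge_tip addrK => ->; rewrite [X in _ - X]w_outside ?subr0 //.
by exists l; right; rewrite vertex_mulrn addrC.
Qed.

(** Outside of the box the ray either avoids the box, or starts below it, in
    which case it can first be moved sideways without changing the potential. *)
Lemma potential_outside K v : (1 < d)%N -> outside v -> N%:Z <= v l + K%:Z ->
  potential K v = 0.
Proof.
move=> d1 vout vK.
have side x : (exists2 j, j != l & (x j < - N%:Z) \/ (N%:Z <= x j)) -> potential K x = 0.
  move=> [j jl xj]; apply: big1 => k _; apply: w_outside; exists j.
  by rewrite vertex_mulrn_other.
have [vl|vl] := ltP (v l) (- N%:Z); last first.
  have [vl'|vl'] := leP N%:Z (v l).
    apply: big1 => k _; apply: w_outside; exists l; right; rewrite vertex_mulrn; lia.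
  case: vout => j vj; apply: side; exists j => //.
  by apply: contraPneq vj => ->; lia.
have [j jl] : exists j : 'I_d, j != l.
  have : (0 < #|predC1 l|)%N by rewrite cardC1 card_ord; lia.
  by case/card_gt0P => j; exists j.
have move_side n : potential K (unit_vector j *+ n + v) = potential K v.
  elim: n => [|n IH]; first by rewrite mulr0n add0r.
  rewrite -IH; pose e : edge d := (unit_vector j *+ n + v, j).
  have tip : edge_tip e = unit_vector j *+ n.+1 + v.
    by rewrite /edge_tip /= mulrSr addrAC.
  have el : e.1 l = v l by rewrite /= vertex_mulrn_other // eq_sym.
  rewrite -tip -[_ *+ n + v]/(e.1) potential_edge; last first.
    by rewrite edge_tipE el; lia.
  rewrite w_edge_out ?addr0 //; apply/negP => /dual_boxP/(_ l); rewrite el; lia.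
rewrite -(move_side (N + absz (v j))%N); apply: side; exists j => //; right.
by rewrite vertex_mulrn; lia.
Qed.

Lemma potential_boundary K v : (1 < d)%N -> boundary (dual_box d N) v ->
  N%:Z <= v l - 1 + K%:Z -> potential K v = 0.
Proof.
move=> d1 [e /= /negP eE ve] vK.
have eout : outside e.1 \/ outside (edge_tip e).
  have [/existsP[j /orP ej]|ej] := boolP [exists j, (e.1 j < - N%:Z) || (N%:Z <= edge_tip e j)].
    by case: ej => ej; [left|right]; exists j; [left|right].
  case/negP: eE; apply/dual_boxP => j; move: ej; rewrite negb_exists => /forallP/(_ j).
  by rewrite negb_or; lia.
have tipl : v l <= edge_tip e l /\ v l - 1 <= e.1 l.
  by case: ve => ->; rewrite edge_tipE; case: (l == e.2) => /=; lia.
have e12 : potential K e.1 = potential K (edge_tip e).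
  by rewrite potential_edge ?w_edge_out ?addr0 //; lia.
have e0 : potential K e.1 = 0.
  by case: eout => eo; [|rewrite e12]; apply: potential_outside => //; lia.
by case: ve => ->; rewrite -?e12.
Qed.

End Potential.

Lemma plaquette_cell_inj (d : nat) : injective (@plaquette_cell d).
Proof. by move=> [x i] [y j] [-> /finset.setC_inj/finset.set1_inj ->]. Qed.

Section Duality.
Variables (A : nzRingType) (d : nat) (l : 'I_d) (N : nat).
Hypotheses (l_last : last_dir l) (N_gt0 : (0 < N)%N).
Implicit Types (P : {fset plaquette d}) (x y v : vertex d) (c : plaquette d).

Local Notation sgn i := (@dual_sign A d i).
Local Notation edges := (dual_box d N).

Definition dual_open P : {fset edge d} :=
  [fset dual_edge c | c in (interior_plaquettes d N `\` P)%fset]%fset.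

Definition halfspace v : A := (0 <= v l)%R%:R.

Lemma mem_dual_open P e : (e \in dual_open P) =
  (e \in edges) && (dual_plaquette e \notin P).
Proof.
rewrite -{1 2}(dual_plaquetteK e) (mem_imfset _ _ (@dual_edge_inj d)) /= inE.
by rewrite dual_edge_in_box in_interior_plaquettes andbC.
Qed.

Lemma halfspace_step (i : 'I_d) x :
  halfspace (x - unit_vector i) - halfspace x = - ((i == l) && (x l == 0%R))%:R.
Proof.
rewrite /halfspace vertexD vertexN ffunE eq_sym; case: eqP => _ /=; last first.
  by rewrite subr0 subrr oppr0.
case: (eqVneq (x l) 0) => [x0|x0].
  have -> : (0 <= x l - 1) = false by lia.
  have -> : (0 <= x l) = true by lia.
  by rewrite sub0r.
rewrite (_ : (0 <= x l - 1) = (0 <= x l)) ?subrr ?oppr0 //; lia.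
Qed.

Lemma disk_plaquette c : @disk A d N (plaquette_cell c) =
  [&& interior_cell N (plaquette_cell c), c.2 == l & c.1 l == 0%R]%:R.
Proof.
case: c => x i; rewrite /disk; congr (nat_of_bool _)%:R.
apply/andP/and3P => [[xN /existsP[j /and3P[jl xj /eqP ij]]]|[iN /eqP il xl]].
  have {}jl : j = l by apply/val_inj/succn_inj; rewrite (eqP jl) (eqP l_last).
  have {}ij : i = l.
    by rewrite -jl; apply/set1P; rewrite -(finset.setCK [set j]%SET) -ij finset.setCK set11.
  rewrite {}jl in xj; subst i; split=> //; apply/interior_plaquetteP => k /=.
  have /forallP/(_ k) /= := xN; rewrite !inE; case: eqVneq => [->|_] /=; last by lia.
  by rewrite (eqP xj); lia.
split; first by case/andP: iN.
by apply/existsP; exists l; move: il => /= ->; rewrite l_last xl eqxx.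
Qed.

Lemma disk_other (c : cell d) : (forall i, c.2 != ~: [set i])%SET -> @disk A d N c = 0.
Proof.
move=> ci; rewrite /disk; case: andP => //= -[_ /existsP[i /and3P[_ _ /eqP ic]]].
by have := ci i; rewrite ic eqxx.
Qed.

(** If no open path crosses, the vertices joined to the upper side form a set
    [U] that agrees with the upper half-space on the boundary.  The boundaries
    of the two as top-dimensional chains differ by a cycle, which replaces the
    disk by the plaquettes separating [U] from its complement. *)
Lemma null_homologous_of_cut P : cut l edges (dual_open P) ->
  null_homologous P (@gamma A d N).
Proof.
move=> cutP.
pose J := [set` (dual_open P `&` edges)%fset].
pose U v : A := `[< exists u, [/\ boundary edges u, (0 <= u l)%R & joined J u v] >]%:R.
have U_boundary v : boundary edges v -> U v = halfspace v.
  move=> bv; rewrite /U /halfspace; congr (nat_of_bool _)%:R.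
  apply/asboolP/idP => [[u [bu u0 uv]]|v0]; last by exists v; split=> //; exact: joined_refl.
  by rewrite leNgt; apply/negP => v0; exact: (cutP u v).
have U_open e : J e -> U e.1 = U (edge_tip e).
  move=> Je; rewrite /U; congr (nat_of_bool _)%:R; apply/asboolP/asboolP => -[u [bu u0 uv]];
    exists u; split=> //; apply: joined_trans uv _; [exact: joined_edge|exact: joined_edgeV].
exists (fun b => disk A N b - sgn l * (chain_boundary (top_chain U) b -
                                      chain_boundary (top_chain halfspace) b)).
split; last first.
  move=> c; rewrite chain_boundaryB chain_boundary_dual_sign chain_boundaryB.
  by rewrite !chain_boundary2_top subrr mulr0 subr0.
move=> c fc; have [/existsP[i /eqP ci]|ci] := boolP [exists i, c.2 == ~: [set i]]%SET; last first.
  move: fc; have {}ci i : (c.2 != ~: [set i])%SET.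
    by apply: contra ci => ci; apply/existsP; exists i.
  by rewrite disk_other // !chain_boundary_top0 // subrr mulr0 subr0 eqxx.
case: c ci fc => x S /= ->; set c : plaquette d := (x, i).
rewrite (_ : (x, _) = plaquette_cell c) //.
have [cP _|cP] := boolP (c \in P); first by exists c.
rewrite /plaquette_cell /= !chain_boundary_top -mulrBr -/(plaquette_cell c) disk_plaquette.
have [cN|cN] := boolP (interior_cell N (plaquette_cell c)) => /=.
  have Je : J (dual_edge c).
    by rewrite /J /= !inE mem_dual_open dual_edge_in_box cN dual_edgeK cP.
  have := U_open _ Je; rewrite /edge_tip /= subrK => ->.
  rewrite subrr sub0r halfspace_step opprK.
  case: (eqVneq i l) => [->|_] /=; last by rewrite !mulr0 subr0 eqxx.
  by rewrite dual_signK subrr eqxx.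
have cE : ~ [set` edges] (dual_edge c).
  by rewrite /= dual_edge_in_box; exact/negP.
rewrite (U_boundary x); last first.
  by exists (dual_edge c) => //; right; rewrite /edge_tip /= subrK.
rewrite U_boundary; last by exists (dual_edge c) => //; left.
by rewrite subrr !mulr0 subrr eqxx.
Qed.

(** Let [f] be a filling.  Its difference with the disk is a cycle in the box,
    hence a closed 1-form on the dual lattice with finite support: it has a
    potential that vanishes on the boundary.  Along an open path only the disk
    contributes, so the potential changes by the number of signed crossings of
    the hyperplane, which is nonzero between the two sides. *)
Lemma cut_of_null_homologous P : (1 < d)%N ->
  null_homologous P (@gamma A d N) -> (P `<=` interior_plaquettes d N)%fset ->
  cut l edges (dual_open P).
Proof.
move=> d1 [f [fP bf]] PN x y bx by_ x0 y0 xy.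
have fnP c : c \notin P -> f (plaquette_cell c) = 0.
  move=> cP; apply/eqP; apply: contraNT cP => /fP[a aP].
  by move=> /plaquette_cell_inj ->.
pose z : chain A d := fun b => f b - @disk A d N b.
pose w := dual_form z.
have w_out c : ~~ interior_cell N (plaquette_cell c) -> w c = 0.
  move=> cN; rewrite /w /dual_form /z disk_plaquette (negPf cN) subr0 fnP ?mulr0 //.
  by apply: contra cN => /(fsubsetP PN); rewrite in_interior_plaquettes.
have w_closed v (i j : 'I_d) : i != j ->
    w (v - unit_vector i, j) - w (v, j) = w (v - unit_vector j, i) - w (v, i).
  move=> ij; apply/chain_boundary_curl_eq0 => //.
  by rewrite chain_boundaryB bf subrr.
(* The rays from all the vertices considered must leave the box: those on the
   path are at height at least [- N], those at the ends and their neighbours at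
   least one below [x] or [y]. *)
pose K := (2 * N + absz (x l) + absz (y l) + 2)%N.
pose g := potential l w K.
have gx : g x = 0 by apply: (potential_boundary w_out w_closed d1 bx); lia.
have gy : g y = 0 by apply: (potential_boundary w_out w_closed d1 by_); lia.
pose I v := g v - sgn l * halfspace v = - sgn l.
have Ix : I x by rewrite /I gx /halfspace x0 mulr1 sub0r.
suff : I y.
  rewrite /I gy /halfspace leNgt y0 /= mulr0 subr0 => /esym/eqP.
  by rewrite oppr_eq0 signr_eq0.
apply: (@joined_ind _ _ I x y _ xy) => // e /=.
rewrite !inE mem_dual_open => /andP[/andP[eE eP] _].
rewrite /I /g (potential_edge w_out w_closed); last first.
  have /dual_boxP/(_ l) [e1 _] := eE; rewrite edge_tipE; lia.
have -> : w (dual_plaquette e) = sgn l * (halfspace e.1 - halfspace (edge_tip e)).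
  rewrite -[e.1](addrK (unit_vector e.2)) -/(edge_tip e) halfspace_step.
  rewrite /w /dual_form /z fnP // sub0r disk_plaquette -dual_edge_in_box dual_plaquetteK eE /=.
  by case: (eqVneq e.2 l) => [->|_] //=; rewrite !oppr0 !mulr0.
by rewrite mulrBr addrA addrAC addrK.
Qed.

Lemma null_homologous_cut P : (1 < d)%N -> (P `<=` interior_plaquettes d N)%fset ->
  null_homologous P (@gamma A d N) <-> cut l edges (dual_open P).
Proof.
move=> d1 PN; split=> [h|]; first exact: cut_of_null_homologous.
exact: null_homologous_of_cut.
Qed.

End Duality.

(** * Plaquettes in a free cube and edges in a wired cube *)

Lemma mem_dual_edges (d : nat) (P : {fset plaquette d}) (e : edge d) :
  (e \in [fset dual_edge c | c in P]%fset) = (dual_plaquette e \in P).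
Proof. by rewrite -{1}(dual_plaquetteK e) (mem_imfset _ _ (@dual_edge_inj d)). Qed.

Lemma mem_dual_box (d N : nat) (e : edge d) :
  (e \in dual_box d N) = (dual_plaquette e \in interior_plaquettes d N).
Proof. exact: mem_dual_edges. Qed.

(** With the empty boundary condition every dual edge that does not cross an
    interior plaquette is open. *)
Lemma fk_prob_of_prcm (R : realType) (d N : nat) (p q : R) (D : set {fset edge d})
    (D' : set {fset plaquette d}) :
  0 < p -> p < 1 -> 0 < dual_param p q -> dual_param p q < 1 -> 1 <= q ->
  (forall P, (P `<=` interior_plaquettes d N)%fset -> (D (dual_open N P) <-> D' P)) ->
  prcm_prob N p q set0 D' = fk_prob (dual_param p q) q (dual_box d N) D.
Proof.
move=> p0 p1 ps0 ps1 q1 DD'; pose V := [set x : vertex d | dual_vertex_in_box N x].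
have finV : finite_set V by exact: finite_box_dual_vertices.
have EV : edge_ends (dual_box d N) `<=` V.
  move=> v [e /= /dual_boxP eN ve]; apply/forallP => j /=; have := eN j.
  by case: ve => ->; rewrite edge_tipE !inE; case: (j == e.2) => /=; lia.
have [K K0 KP] := fk_weight_proportional (dual_param p q) q1 finV EV.
pose close (Q : {fset edge d}) : {fset plaquette d} :=
  [fset c in interior_plaquettes d N | dual_edge c \notin Q]%fset.
rewrite /prcm_prob /fk_prob; apply/esym.
apply: (@fin_prob_bij R _ _ (interior_plaquettes d N) (dual_box d N) (@dual_open d N)
  close (prcm_weight N p q set0) _ K^-1 D' D) => //.
- by move=> P PN; apply/fsubsetP => e; rewrite mem_dual_open => /andP[].
- by move=> Q QE; apply/fsubsetP => c; rewrite !inE => /andP[].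
- move=> P PN; apply/fsetP => c; rewrite !inE mem_dual_open dual_edgeK.
  rewrite dual_edge_in_box -in_interior_plaquettes negb_and negbK.
  by have := fsubsetP PN c; case: (c \in P) => [->//|_]; rewrite orbF andbN.
- move=> Q QE; apply/fsetP => e; rewrite mem_dual_open !inE dual_plaquetteK.
  rewrite in_interior_plaquettes -dual_edge_in_box dual_plaquetteK negb_and negbK.
  by have := fsubsetP QE e; case: (e \in Q) => [->|_]; rewrite ?orbT // orbF andbN.
- by rewrite invr_eq0.
move=> P PN; have PE : (dual_open N P `<=` dual_box d N)%fset.
  by apply/fsubsetP => e; rewrite mem_dual_open => /andP[].
apply: (mulfI K0); rewrite -KP // mulVKf // /fk_weight /prcm_weight.
congr (_ ^+ _ * _ ^+ _ * _ ^+ _).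
- by rewrite card_imfset //; exact: dual_edge_inj.
- have <- : #|` [fset dual_edge c | c in P]%fset| = #|` P|.
    by apply: card_imfset; exact: dual_edge_inj.
  congr #|` _|; apply/fsetP => e.
  rewrite inE mem_dual_open mem_dual_box mem_dual_edges negb_and negbK.
  by have := fsubsetP PN (dual_plaquette e); case: (_ \in P) => [->|_] //; rewrite orbF andNb.
congr (ncomponents _ _); apply/seteqP; split=> e.
  case=> [/= |/= eE]; first by move=> /imfsetP[c /= cP ->]; exists c => //; left.
  exists (dual_plaquette e); last exact: dual_plaquetteK.
  right; split=> //; move/negP: eE; rewrite -{1}(dual_plaquetteK e) dual_edge_in_box.
  by rewrite /interior_cell negb_and negbK => /orP[]; [left|right].
move=> [c [cP|[cN _]] <-]; [left|right] => /=.
  by apply/imfsetP; exists c.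
rewrite dual_edge_in_box /interior_cell; case: cN => [/negPf ->//|->].
by rewrite andbF.
Qed.

Section Wired.
Variables (d N : nat).
Implicit Types (Q : {fset edge d}) (x y v : vertex d) (e : edge d).

Local Notation edges := (interior_edges d N).

Definition clamp_int (a : int) : int :=
  if a < - N%:Z then - N%:Z else if N%:Z < a then N%:Z else a.

Lemma clamp_intP (a : int) :
  (a < - N%:Z /\ clamp_int a = - N%:Z) \/ (N%:Z < a /\ clamp_int a = N%:Z) \/
  (- N%:Z <= a /\ a <= N%:Z /\ clamp_int a = a).
Proof. by rewrite /clamp_int; case: ltP => // h; case: ltP => // h'; lia. Qed.

Lemma clamp_int_id (a : int) : - N%:Z <= a <= N%:Z -> clamp_int a = a.
Proof. have := clamp_intP a; lia. Qed.

Lemma clamp_int_out (a : int) : ~~ ((- N%:Z <= a) && (a < N%:Z)) ->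
  clamp_int a = clamp_int (a + 1).
Proof. have := clamp_intP a; have := clamp_intP (a + 1); lia. Qed.

Lemma clamp_int_in (a : int) : - N%:Z <= a -> a < N%:Z ->
  clamp_int a + 1 = clamp_int (a + 1).
Proof. have := clamp_intP a; have := clamp_intP (a + 1); lia. Qed.

Definition clamp v : vertex d := [ffun j => clamp_int (v j)].

Lemma clampE v j : clamp v j = clamp_int (v j).
Proof. by rewrite ffunE. Qed.

Lemma in_boxE x : vertex_in_box N x = [forall j, - N%:Z <= x j <= N%:Z].
Proof. by apply: eq_forallb => j /=; rewrite finset.in_set0 addr0. Qed.

Lemma clamp_id v : vertex_in_box N v -> clamp v = v.
Proof.
rewrite in_boxE => /forallP vN; apply/ffunP => j; rewrite ffunE.
by apply: clamp_int_id; exact: vN.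
Qed.

Lemma clamp_edge e : e \notin edges ->
  clamp e.1 = clamp (edge_tip e) \/
  exists2 f, in_bdbox N (edge_cell f) & f.1 = clamp e.1 /\ edge_tip f = clamp (edge_tip e).
Proof.
move=> eE; have tip_other j : j != e.2 -> edge_tip e j = e.1 j.
  by move=> /negPf je; rewrite edge_tipE je addr0.
have tip_dir : edge_tip e e.2 = e.1 e.2 + 1 by rewrite edge_tipE eqxx.
have [/andP[e1 e2]|out] := boolP ((- N%:Z <= e.1 e.2) && (e.1 e.2 < N%:Z)); last first.
  left; apply/ffunP => j; rewrite !clampE.
  have [->|/tip_other -> //] := eqVneq j e.2; rewrite tip_dir.
  exact: clamp_int_out.
right; exists (clamp e.1, e.2); last first.
  split=> //; apply/ffunP => j; rewrite edge_tipE /= !clampE.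
  have [->|/[dup] /negPf jne /tip_other ->] := eqVneq j e.2; rewrite ?tip_dir.
    exact: clamp_int_in.
  exact: addr0.
apply/andP; split.
  apply/forallP => j /=; rewrite inE clampE; have := clamp_intP (e.1 j).
  by have [->|_] := eqVneq j e.2; rewrite /=; lia.
have [/existsP[j /andP[je jN]]|ex] :=
    boolP [exists j, (j != e.2) && ~~ (- N%:Z < e.1 j < N%:Z)].
  apply/existsP; exists j; rewrite /= inE je clampE /=.
  have := clamp_intP (e.1 j); lia.
case/negP: eE; apply/interior_edgeP => j.
have [->|je] := eqVneq j e.2; first by rewrite tip_dir; split=> //; lia.
rewrite tip_other //; move: ex; rewrite negb_exists => /forallP/(_ j).
by rewrite je negbK /= => h; split=> //; lia.
Qed.

(** Retracting the lattice onto the box turns every edge that is not interior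
    into an edge of the boundary or a point, so opening all the edges outside
    connects no more vertices of the box than wiring its boundary. *)
Lemma joined_wired Q x y : (Q `<=` edges)%fset ->
  vertex_in_box N x -> vertex_in_box N y ->
  joined (wired_graph N Q) x y <-> joined (open_outside edges Q) x y.
Proof.
move=> QE xN yN; split.
  apply: joined_mono => e [/= eQ|/= eb]; [by left|right => /=].
  by rewrite in_interior_edges /interior_cell eb andbF.
move=> xy; rewrite -(clamp_id xN) -(clamp_id yN).
have step : forall e, open_outside edges Q e ->
    joined (wired_graph N Q) (clamp e.1) (clamp (edge_tip e)).
  move=> e [/= eQ|/= /negP eE].
    have /interior_edgeP eN := fsubsetP QE e eQ.
    rewrite !clamp_id; first by apply: joined_edge; left.
      rewrite in_boxE; apply/forallP => j; have [] := eN j.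
      by rewrite edge_tipE; case: (j == e.2) => /=; lia.
    rewrite in_boxE; apply/forallP => j; have [] := eN j.
    by rewrite edge_tipE; case: (j == e.2) => /=; lia.
  have [->|[f fb [<- <-]]] := clamp_edge eE; first exact: joined_refl.
  by apply: joined_edge; right.
apply: (@joined_ind _ _ (fun z => joined (wired_graph N Q) (clamp x) (clamp z)) x y _ xy).
  move=> e /step h; split=> h'; apply: joined_trans h' _ => //; exact: joined_sym.
exact: joined_refl.
Qed.

Lemma wired_rcm_prob_fk (R : realType) (p q : R) (D : set {fset edge d}) :
  0 < p -> p < 1 -> 1 <= q ->
  wired_rcm_prob N p q D = fk_prob p q edges D.
Proof.
move=> p0 p1 q1; pose V := [set x : vertex d | vertex_in_box N x].
have finV : finite_set V by exact: finite_box_vertices.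
have EV : edge_ends edges `<=` V.
  move=> v [e /= /interior_edgeP eN ve]; rewrite -[V v]/(is_true (vertex_in_box N v)).
  rewrite in_boxE; apply/forallP => j.
  by have [] := eN j; case: ve => ->; rewrite edge_tipE; case: (j == e.2) => /=; lia.
have [K K0 KP] := fk_weight_proportional p q1 finV EV.
apply: (fin_prob_same K0) => // Q QE; rewrite -KP // /wired_rcm_weight /fk_weight.
rewrite cardfsDS //; congr (_ * _ ^+ _); apply: eq_ncomponents => // x y Vx Vy.
exact: joined_wired.
Qed.

End Wired.

Section Surface.
Variables (d N : nat) (l : 'I_d).
Implicit Types (Q : {fset edge d}) (x y v : vertex d) (e : edge d).

Local Notation edges := (interior_edges d N).

(** The interior edges at the boundary vertices of height zero are among those
    whose base point, lowered by one, starts a crossing edge of the outermost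
    layer of the dual box; in this form they are easily counted. *)
Definition neutral_edges : {fset edge d} :=
  [fset e in edges | (((e.1 - unit_vector l, l) : edge d) \in
    crossing l (dual_box d N) `\` crossing l (dual_box d N.-1))]%fset.

Lemma lowered_edgeP M v : v l = 0 ->
  reflect ((0 < M)%N /\ forall j, j != l -> - M%:Z <= v j < M%:Z)
    ((v - unit_vector l, l) \in dual_box d M).
Proof.
move=> vl; apply: (iffP (dual_boxP _ _)) => [vM|[M0 vM] j].
  split=> [|j jl].
    by have := vM l; rewrite edge_tipE /= vertexD vertexN ffunE vl eqxx /=; lia.
  by have := vM j; rewrite edge_tipE /= vertexD vertexN ffunE (negPf jl) /=; lia.
rewrite edge_tipE /= vertexD vertexN ffunE.
have [->|jl] := eqVneq j l; first by rewrite vl /=; lia.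
by have := vM j jl; rewrite /=; lia.
Qed.

Lemma card_neutral_edges :
  (#|` neutral_edges| + d * #|` crossing l (dual_box d N.-1)| <=
   d * #|` crossing l (dual_box d N)|)%N.
Proof.
pose C := (crossing l (dual_box d N) `\` crossing l (dual_box d N.-1))%fset.
have sub : (crossing l (dual_box d N.-1) `<=` crossing l (dual_box d N))%fset.
  apply/fsubsetP => e; rewrite !inE /= => /andP[/dual_boxP eN ->]; rewrite andbT.
  by apply/dual_boxP => j; have := eN j; lia.
suff : (#|` neutral_edges| <= d * #|` C|)%N.
  by rewrite cardfsDS // mulnBr; have := fsubset_leq_card sub; nia.
pose phi (e : edge d) : edge d * 'I_d := ((e.1 - unit_vector l, l), e.2).
have phi_inj : injective phi by move=> [x i] [y j] [/addIr -> ->].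
have -> : (d * #|` C|)%N = size [seq (c, i) | c <- C, i <- enum 'I_d].
  by rewrite size_allpairs size_enum_ord mulnC.
rewrite -(size_map phi); apply: uniq_leq_size.
  by rewrite map_inj_uniq ?fset_uniq.
move=> _ /mapP[e eF ->]; apply/allpairsP; exists (phi e); split=> //=.
  by move: eF; rewrite inE => /andP[].
by rewrite mem_enum.
Qed.

Hypotheses (l_last : last_dir l) (N_gt0 : (0 < N)%N).

Lemma boundary_of_bdbox x : vertex_in_bdbox N x -> boundary edges x.
Proof.
move=> /andP[_ /existsP[j /andP[_ /= xj]]].
have [xjN|xjN] : x j = N%:Z \/ x j = - N%:Z by lia.
  exists (x, j); last by left.
  by move=> /= /interior_edgeP/(_ j)[_]; rewrite edge_tipE /= eqxx; lia.
exists (x - unit_vector j, j); last by right; rewrite /edge_tip /= subrK.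
by move=> /= /interior_edgeP/(_ j)[]; rewrite /= vertexD vertexN ffunE eqxx; lia.
Qed.

Lemma bdbox_of_boundary x : boundary edges x -> touches [set` edges] x ->
  vertex_in_bdbox N x.
Proof.
move=> [e /= eE xe] [f /= /interior_edgeP fE xf]; apply/andP; split.
  suff : vertex_in_box N x by [].
  rewrite in_boxE; apply/forallP => j; have [] := fE j.
  by case: xf => ->; rewrite edge_tipE; case: (j == f.2) => /=; lia.
apply: contraT => nb; case: eE; apply/interior_edgeP => j.
move: nb; rewrite negb_exists => /forallP/(_ j) /=; rewrite finset.in_set0 /=.
have : - N%:Z <= x j <= N%:Z.
  have [] := fE j.
  by case: xf => ->; rewrite edge_tipE; case: (j == f.2) => /=; lia.
move=> xN xjN; have {xN xjN} : - N%:Z < x j < N%:Z by lia.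
by case: xe => ->; rewrite edge_tipE; case: (j == e.2) => /= ?; split=> //; lia.
Qed.

Lemma last_dirP (P : 'I_d -> bool) : [exists i, last_dir i && P i] = P l.
Proof.
apply/existsP/idP => [[i /andP[/eqP il Pi]]|Pl]; last by exists l; rewrite l_last.
by have <- : i = l by apply/val_inj/succn_inj; rewrite il (eqP l_last).
Qed.

Lemma disconnection_of_cut Q : (Q `<=` edges)%fset ->
  cut l edges Q -> @disconnection_event d N Q.
Proof.
move=> QE cutQ [x [y [/andP[bx +] /andP[by_ +] xy]]].
rewrite !last_dirP => x0 y0; apply: (cutQ x y) => //; try exact: boundary_of_bdbox.
  exact: ltW.
by rewrite (fsetIidPl QE).
Qed.

(** The boundary vertices of height zero belong to the upper side of the cut but
    to neither side of the disconnection event; closing the edges at them makes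
    up for it. *)
Lemma cut_of_disconnection Q : (Q `<=` edges)%fset ->
  @disconnection_event d N Q -> [disjoint Q & neutral_edges]%fset -> cut l edges Q.
Proof.
move=> QE disQ QF x y bx by_ x0 y0; rewrite (fsetIidPl QE) => xy.
have xny : x <> y by move=> xy'; move: y0; rewrite -xy' ltNge x0.
have touchE v : touches [set` Q] v -> touches [set` edges] v.
  by move=> [e /= /(fsubsetP QE) eE ve]; exists e.
have [//|ty] := joined_touches xy.
have [/esym//|[e /= eQ xe]] := joined_touches (joined_sym xy).
have tx : touches [set` edges] x by apply: touchE; exists e.
have bbx := bdbox_of_boundary bx tx.
have bby := bdbox_of_boundary by_ (touchE _ ty).
have [xl|xl] := ltP 0 (x l).
  apply: disQ; exists x, y; split=> //; apply/andP; split=> //; rewrite last_dirP //.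
have {}xl : x l = 0 by lia.
have eE := fsubsetP QE e eQ; have /interior_edgeP eN := eE.
suff eF : e \in neutral_edges by move/fdisjointP: QF => /(_ e eQ); rewrite eF.
case/andP: bbx => _ /existsP[j /andP[_ /= xj]].
have jl : j != l by apply: contraTneq xj => ->; rewrite xl; lia.
have je : j = e.2.
  apply/eqP; apply: contraT => je; have [_ _ /(_ je)] := eN j.
  by move: xj; case: xe => ->; rewrite ?edge_tipE ?(negPf je) /=; lia.
have le : (l == e.2) = false by rewrite -je eq_sym; exact: negbTE.
have el : e.1 l = 0 by move: xl; case: xe => ->; rewrite ?edge_tipE ?le ?addr0.
have cross M : ((e.1 - unit_vector l, l) \in crossing l (dual_box d M)) =
    ((e.1 - unit_vector l, l) \in dual_box d M).
  by rewrite !inE /= vertexD vertexN ffunE !eqxx el andbT.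
rewrite inE; apply/andP; split; first exact: eE.
rewrite in_fsetD !cross; apply/andP; split; last first.
  apply/(lowered_edgeP _ el); split=> // i il; have [e1 + e3] := eN i.
  by rewrite edge_tipE; move: e3; case: (i == e.2) => /= [_|/(_ isT)]; lia.
apply/negP => /(lowered_edgeP _ el)[_ /(_ j jl)].
have [e1 e2 _] := eN j.
by move: xj e1 e2; case: xe => ->; rewrite !edge_tipE je eqxx /=; lia.
Qed.

End Surface.

(** * The two tensions *)

Lemma card_crossing (d N : nat) (l : 'I_d) : (1 < d)%N ->
  #|` crossing l (dual_box d N)| = ((2 * N) ^ d.-1)%N.
Proof.
move=> d1; case: N => [|N]; last exact: card_crossing_dual_box.
rewrite muln0 exp0n ?ltn_predRL //; apply/eqP; rewrite cardfs_eq0.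
apply/eqP/fsetP => e; rewrite !inE; apply/negP => /andP[/dual_boxP/(_ l) + _].
by rewrite edge_tipE; case: (l == e.2) => /=; lia.
Qed.

Section Assembly.
Variables (R : realType) (d : nat) (l : 'I_d) (p q : R).
Hypotheses (p_gt0 : 0 < p) (p_lt1 : p < 1) (q_ge1 : 1 <= q).
Hypotheses (d_gt1 : (1 < d)%N) (l_last : last_dir l).

Local Notation D := d.-1.
Local Notation c := (- ln (1 - p)).
Local Notation box_excess N := (excess l p q (dual_box d N)).

Lemma cost_excess E : cost l p q E = excess l p q E + c * #|` crossing l E|%:R.
Proof. by rewrite /excess mulNr addrK. Qed.

Lemma cost_dual_box N :
  cost l p q (dual_box d N) = box_excess N + c * (2 * N%:R) ^+ D.
Proof. by rewrite cost_excess card_crossing // natrX natrM. Qed.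

Let c_ge0 : 0 <= c.
Proof. by rewrite oppr_ge0 ln_le0 // lerBlDr lerDl ltW. Qed.

Lemma box_excess_cvg :
  exists L : R, box_excess N / (2 * N%:R) ^+ D @[N --> \oo] --> L.
Proof.
apply: (@cvg_tiling _ _ _ c) => [M|M M0|N k M N0 k0 kNM].
- exact: excess_le0.
- have := cost_ge0 l p_gt0 p_lt1 q_ge1 (dual_box d M).
  by rewrite cost_dual_box; lra.
- exact: excess_tiling.
Qed.

Lemma surface_cost_le n :
  - ln (wired_rcm_prob n.+1 p q (@disconnection_event d n.+1)) <=
  box_excess n + c * (2 * n.+2%:R) ^+ D.
Proof.
rewrite wired_rcm_prob_fk //; set E := interior_edges d n.+1.
have D0 : @disconnection_event d n.+1 fset0.
  by apply: (disconnection_of_cut l_last) => //; exact: cut0.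
have -> : box_excess n + c * (2 * n.+2%:R) ^+ D =
    box_excess n + c * #|` crossing l (dual_box d n.+2)|%:R.
  by rewrite card_crossing // natrX natrM.
apply: (@le_trans _ _ (cost l p q E)).
  rewrite lerN2 ler_ln ?posrE ?fk_prob_cut_gt0 ?fk_prob_gt0 //.
  apply: fin_prob_le => [Q|Q QE]; first exact: fk_weight_gt0.
  exact: disconnection_of_cut.
rewrite cost_excess lerD //.
  by apply: excess_decreasing => //; exact: dual_box_sub_interior_edges.
rewrite ler_wpM2l // ler_nat; apply: fsubset_leq_card; apply/fsubsetP => e.
rewrite !inE => /andP[eE ->]; rewrite andbT.
exact: (fsubsetP (interior_edges_sub_dual_box d n.+1)).
Qed.

(** The FKG inequality bounds the cost of the cut by that of the disconnection
    event and of closing the neutral edges. *)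
Lemma surface_cost_ge n :
  box_excess n.+2 + c * (2 * n%:R) ^+ D -
    c * d%:R * ((2 * n.+1%:R) ^+ D - (2 * n%:R) ^+ D) <=
  - ln (wired_rcm_prob n.+1 p q (@disconnection_event d n.+1)).
Proof.
rewrite wired_rcm_prob_fk //; set E := interior_edges d n.+1.
have D0 : @disconnection_event d n.+1 fset0.
  by apply: (disconnection_of_cut l_last) => //; exact: cut0.
set F := neutral_edges n.+1 l.
have FE : (F `<=` E)%fset by apply/fsubsetP => e; rewrite inE => /andP[].
have card_le : c * #|` F|%:R <= c * d%:R * ((2 * n.+1%:R) ^+ D - (2 * n%:R) ^+ D).
  rewrite -mulrA ler_wpM2l // mulrBr lerBrDr.
  have := card_neutral_edges n.+1 l; rewrite /= !card_crossing // -(ler_nat R).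
  by rewrite natrD !natrM !natrX !natrM.
have cross_le : c * (2 * n%:R) ^+ D <= c * #|` crossing l E|%:R.
  rewrite -natrM -natrX -(@card_crossing _ _ l) // ler_wpM2l // ler_nat.
  apply: fsubset_leq_card; apply/fsubsetP => e.
  rewrite !inE => /andP[eE ->]; rewrite andbT.
  exact: (fsubsetP (dual_box_sub_interior_edges d n)).
have ex_le : box_excess n.+2 <= excess l p q E.
  by apply: excess_decreasing => //; exact: interior_edges_sub_dual_box.
suff : cost l p q E <= - ln (fk_prob p q E (@disconnection_event d n.+1)) + c * #|` F|%:R.
  by rewrite cost_excess; lra.
have decD : decreasing (@disconnection_event d n.+1).
  move=> P Q PQ dQ [x [y [ux ly xy]]]; apply: dQ; exists x, y; split=> //.
  by apply: joined_mono xy; exact: fsubsetP.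
have decF : decreasing [set Q : {fset edge d} | [disjoint Q & F]%fset].
  by move=> P Q PQ /=; exact: fdisjointWl.
have p'_gt0 : 0 < 1 - p by rewrite subr_gt0.
have probD_gt0 := fk_prob_gt0 p_gt0 p_lt1 q_ge1 E D0.
have cut_gt0 := fk_prob_cut_gt0 l p_gt0 p_lt1 q_ge1 E.
suff le_cut : fk_prob p q E (@disconnection_event d n.+1) * (1 - p) ^+ #|` F| <=
    fk_prob p q E (cut l E).
  rewrite /cost; move: probD_gt0 cut_gt0 le_cut; move: (fk_prob p q E _) => a.
  move: (fk_prob p q E _) => b a_gt0 b_gt0 ab.
  rewrite mulNr -opprD lerN2 mulr_natr -lnXn // -lnM ?posrE ?exprn_gt0 //.
  by rewrite ler_ln ?posrE // mulr_gt0 // exprn_gt0.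
apply: (@le_trans _ _ (fk_prob p q E (@disconnection_event d n.+1) *
    fk_prob p q E [set Q | [disjoint Q & F]%fset])).
  by rewrite ler_pM2l // fk_prob_closed.
apply: le_trans (fk_prob_fkg p_gt0 p_lt1 q_ge1 _ decD decF) _.
apply: fin_prob_le => [Q|Q QE [dQ QF]]; first exact: fk_weight_gt0.
exact: cut_of_disconnection.
Qed.

Lemma surface_tension_cvg (L : R) :
  box_excess N / (2 * N%:R) ^+ D @[N --> \oo] --> L ->
  is_surface_tension d p q (L + c).
Proof.
move=> xL; apply: (cvg_cost_between (k := c * d%:R) xL) => n.
  exact: surface_cost_ge.
exact: surface_cost_le.
Qed.

End Assembly.

Lemma wilson_tension_cvg (R : realType) (k : coefficients) (d : nat) (l : 'I_d)
    (p q L : R) : (1 < d)%N -> last_dir l -> 0 < p -> p < 1 ->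
  0 < dual_param p q -> dual_param p q < 1 -> 1 <= q ->
  excess l (dual_param p q) q (dual_box d N) / (2 * N%:R) ^+ d.-1 @[N --> \oo] --> L ->
  is_wilson_tension k d p q (L - ln (1 - dual_param p q)).
Proof.
move=> d1 l_last p0 p1 ps0 ps1 q1 xL; rewrite /is_wilson_tension -cvg_shiftS /=.
have {}xL : excess l (dual_param p q) q (dual_box d n.+1) / (2 * n.+1%:R) ^+ d.-1
    @[n --> \oo] --> L.
  by rewrite (cvg_shiftS (fun n =>
    excess l (dual_param p q) q (dual_box d n) / (2 * n%:R) ^+ d.-1)).
rewrite [X in X @ _](_ : _ = fun n => excess l (dual_param p q) q (dual_box d n.+1) /
    (2 * n.+1%:R) ^+ d.-1 - ln (1 - dual_param p q)).
  by apply: cvgB => //; exact: cvg_cst.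
apply/funext => n.
rewrite (@fk_prob_of_prcm _ _ _ _ _ (cut l (dual_box d n.+1))) //.
  rewrite -/(cost l (dual_param p q) q (dual_box d n.+1)) cost_dual_box //.
  by rewrite mulrDl mulfK // expf_neq0 // mulf_neq0.
by move=> P PN; rewrite /wilson_event /= (@null_homologous_cut _ _ l).
Qed.

Theorem proposition35 (R : realType) (d : nat) (p q : R) (k : coefficients)
    (hd : (3 <= d)%N) (hq : 1 <= q) (hp0 : 0 < p) (hp1 : p < 1)
    (huniq : unique_infinite_volume d p q) :
  exists tau : R,
    is_wilson_tension k d p q tau /\
    is_surface_tension d (dual_param p q) q tau.
Proof.
have d1 : (1 < d)%N by apply: ltnW.
have [l l_last] : exists l : 'I_d, last_dir l.
  by case: (d) hd => // d' _; exists ord_max; rewrite /last_dir /=.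
have a_gt0 : 0 < (1 - p) * q by rewrite mulr_gt0 ?subr_gt0 // (lt_le_trans ltr01).
have ps0 : 0 < dual_param p q by rewrite divr_gt0 // addr_gt0.
have ps1 : dual_param p q < 1 by rewrite ltr_pdivrMr ?addr_gt0 // mul1r ltrDl.
have [L xL] := box_excess_cvg l ps0 ps1 hq d1.
exists (L - ln (1 - dual_param p q)); split.
  exact: (wilson_tension_cvg k d1 l_last hp0 hp1 ps0 ps1 hq xL).
exact: (surface_tension_cvg ps0 ps1 hq d1 l_last xL).
Qed.
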